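(* In the extra-special case, $$\mathcal M_{\Delta(1)}(t)=\prod_{\gamma\in\Delta(1)}\frac{1-t^{\mathrm{ht}(\gamma)+1}}{1-t^{\mathrm{ht}(\gamma)}}.$$
   Context: Let $\mathfrak g$ be a complex simple Lie algebra with root system $\Delta$ in a real Euclidean space with $W$-invariant inner product $(\,,\,)$, simple roots $\Pi$, highest root $\theta$, $\theta^\vee=2\theta/(\theta,\theta)$. For $\gamma\in\Delta$, $\mathrm{ht}(\gamma)$ is the sum of the coefficients of $\gamma$ in the basis $\Pi$. Extra-special case: $\Delta(j)=\{\gamma\in\Delta:(\gamma,\theta^\vee)=j\}$; $\Pi(0)=\Pi\cap\Delta(0)$; $\Delta(1)$ is partially ordered by $\mu\preccurlyeq\gamma$ iff $\gamma-\mu$ is a nonnegative integer combination of $\Pi(0)$. $\mathcal M_{\Delta(1)}(t)=\sum_I t^{\#I}$, summed over all upper ideals $I$ of $\Delta(1)$ (including $\varnothing$ and $\Delta(1)$). *)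

(* Defs.v *)
From mathcomp Require Import all_boot all_order all_algebra.
From mathcomp Require Import finmap.
From mathcomp Require Import boolp reals.

Set Implicit Arguments.
Unset Strict Implicit.
Unset Printing Implicit Defensive.
Import Order.TTheory GRing.Theory Num.Theory.
Local Open Scope fset_scope.
Local Open Scope ring_scope.

(* [{dot V for idfun}] is the type of positive definite symmetric bilinear
   forms on V. *)

Definition coroot (R : realType) (V : vectType R) (ip : {dot V for idfun})
  (a : V) : V := (2 / ip a a) *: a.

Definition reflection (R : realType) (V : vectType R) (ip : {dot V for idfun})
  (a x : V) : V := x - ip x (coroot ip a) *: a.

(* Irreducible reduced crystallographic root systems: these are the root
   systems of the complex simple Lie algebras.  The reflections are taken
   orthogonal for ip, which is the same as requiring ip to be invariant under
   the Weyl group that they generate. *)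
Record irreducible_root_system (R : realType) (V : vectType R)
    (ip : {dot V for idfun}) (Delta : {fset V}) : Prop := {
  roots_neq0 : 0 \notin Delta;
  roots_span : <<Delta>>%VS = fullv;
  roots_reflection :
    forall a b, a \in Delta -> b \in Delta -> reflection ip a b \in Delta;
  roots_int :
    forall a b, a \in Delta -> b \in Delta ->
      ip b (coroot ip a) \is a Num.int;
  roots_reduced :
    forall (a : V) (c : R), a \in Delta -> c *: a \in Delta ->
      c = 1 \/ c = -1;
  roots_nonempty : Delta != fset0;
  roots_irreducible :
    forall A : {fset V}, A `<=` Delta ->
      (forall a b, a \in A -> b \in Delta `\` A -> ip a b = 0) ->
      A = fset0 \/ A = Delta }.

Definition nonneg_comb (V : nmodType) (S : seq V) (v : V) : Prop :=
  exists c : V -> nat, v = \sum_(a <- S) a *+ c a.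

Record simple_roots (R : realType) (V : vectType R) (Delta : {fset V})
    (n : nat) (Pi : n.-tuple V) : Prop := {
  simple_sub : {subset Pi <= Delta};
  simple_basis : basis_of fullv Pi;
  simple_comb : forall g, g \in Delta ->
    nonneg_comb Pi g \/ nonneg_comb Pi (- g) }.

(* Roots have integer coordinates in Pi, so on them Num.floor only changes the
   type of the sum, from R to int. *)
Definition ht (R : realType) (V : vectType R) (n : nat) (Pi : n.-tuple V)
  (g : V) : int := Num.floor (\sum_(i < n) coord Pi i g).

Definition highest_root (V : zmodType) (Delta : {fset V}) (Pi : seq V)
    (theta : V) : Prop :=
  theta \in Delta /\
  (forall g, g \in Delta -> nonneg_comb Pi (theta - g)).

Definition Delta_ (R : realType) (V : vectType R) (ip : {dot V for idfun})
    (Delta : {fset V}) (theta : V) (j : int) : {fset V} :=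
  [fset g in Delta | ip g (coroot ip theta) == j%:~R].

Definition Pi0 (R : realType) (V : vectType R) (ip : {dot V for idfun})
    (Delta : {fset V}) (Pi : seq V) (theta : V) : seq V :=
  [seq a <- Pi | a \in Delta_ ip Delta theta 0].

Definition preceq (V : zmodType) (S : seq V) (m g : V) : Prop :=
  nonneg_comb S (g - m).

Definition upper_ideal (V : zmodType) (D : {fset V}) (S : seq V)
    (I : {fset V}) : Prop :=
  I `<=` D /\
  (forall m g, m \in I -> g \in D -> preceq S m g -> g \in I).

Definition ideal_poly (V : zmodType) (D : {fset V}) (S : seq V) : {poly int} :=
  \sum_(I <- fpowerset D | `[< upper_ideal D S I >]) 'X^(#|` I|).

(* Main.v *)
(* With w ranging over the Weyl group W, the minimal representatives of the
   cosets of the stabiliser of theta correspond to the long roots w theta, and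
   the length of such a representative is the number l(b) of positive roots d
   with (d, b) < 0, where b = w theta.  Put W0(t) = sum of t^l(b) over the long
   roots b.

   - Macdonald's argument gives W0(t) as the product of (1 - t^(k+1))/(1 - t^k)
     over the heights k of the elements of Delta(1) and of theta: the sum over
     the long roots b of the products of (1 - t y_g)/(1 - y_g) over the roots g
     with (g, b) > 0 has no poles, hence is constant in y.  It is W0(t) at
     y = 0, and at y_g = t^ht(g) only the term of b = theta survives.

   - An upper ideal I of Delta(1) either contains at most one root of each pair
     {g, theta - g}, or has this property after passing to the image of its
     complement under g |-> theta - g; both hold iff #I = m := #Delta(1)/2.  The
     ideals with the property are the sets {g | w(theta - g) < 0}, for w as
     above with w theta > 0, and then #I = l(w theta).

   Hence M(t) is the sum of t^l + t^(2m - l) over the numbers l = l(b), b a long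
   positive root, with the terms l = m counted once, whereas W0(t) is the sum of
   t^l + t^(2m + 1 - l).  With h = ht(theta) + 1, the product formula and the
   symmetry g |-> theta - g of Delta(1) show that W0 vanishes at the h-th roots
   of unity other than 1, which yields (1 - t^h) M = (1 - t^(h-1)) W0. *)
Require Import Defs.
From mathcomp Require Import all_boot all_order all_algebra all_field.
From mathcomp Require Import finmap.
From mathcomp Require Import boolp reals.
From mathcomp Require Import ring lra zify.

Set Implicit Arguments.
Unset Strict Implicit.
Unset Printing Implicit Defensive.
Import Order.TTheory GRing.Theory Num.Theory.
Local Open Scope fset_scope.
Local Open Scope ring_scope.

(** * Zeros of products of factors 1 - c X^a *)

Section RootsOfPolynomials.

Variable C : numClosedFieldType.
Implicit Types (p q : {poly C}) (z c t : C).

Lemma separable_dvdp p q :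
  separable_poly p -> (forall z, root p z -> root q z) -> p %| q.
Proof.
move=> sep_p pq; have p0 := separable_poly_neq0 sep_p.
have [rs p_rs] := closed_field_poly_normal p.
have lp0 : lead_coef p != 0 by rewrite lead_coef_eq0.
rewrite p_rs dvdpZl // uniq_roots_dvdp //.
  apply/allP=> z z_rs; apply: pq.
  by rewrite p_rs rootZ // root_prod_XsubC.
rewrite uniq_rootsE -separable_prod_XsubC.
by rewrite -(eqp_separable (eqp_scale _ lp0)) -p_rs.
Qed.

Lemma separable_1subcXn c a : (0 < a)%N -> c != 0 ->
  separable_poly (1 - c *: 'X^a).
Proof.
move=> a0 c0; rewrite separable_poly.unlock.
apply: Pdiv.ClosedField.root_coprimep => z; rewrite /root !hornerE => z1.
rewrite derivB derivZ derivXn -[1]/(1%:P) derivC sub0r hornerN oppr_eq0.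
rewrite hornerZ hornerMn hornerXn mulf_eq0 mulrn_eq0 (negPf c0) -[a == _]negbK.
rewrite -lt0n a0 /= expf_neq0 //.
apply: contraTneq z1 => ->.
by rewrite expr0n eqn0Ngt a0 mulr0 subr0 oner_eq0.
Qed.

Lemma size_1subcXn c a : (0 < a)%N -> c != 0 -> size (1 - c *: 'X^a) = a.+1.
Proof.
move=> a0 c0; rewrite addrC size_polyDl size_polyN size_scale // size_polyXn //.
by rewrite size_poly1.
Qed.

Lemma separable_prod_1subcXn (T : eqType) (s : seq T) (c : T -> C)
    (a : T -> nat) :
  uniq s -> {in s, forall i, (0 < a i)%N} -> {in s, forall i, c i != 0} ->
  {in s &, forall i j, i != j ->
    forall z, c i * z ^+ a i = 1 -> c j * z ^+ a j != 1} ->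
  separable_poly (\prod_(i <- s) (1 - c i *: 'X^(a i))).
Proof.
elim: s => [|i s IHs] /=.
  by move=> _ _ _ _; rewrite big_nil separable_poly.unlock coprime1p.
case/andP=> i_s us a0 c0 disj; rewrite big_cons separable_mul.
have sub j : j \in s -> j \in i :: s by rewrite inE orbC => ->.
rewrite separable_1subcXn ?a0 ?c0 ?mem_head //= IHs //=; first last.
- by move=> j k /sub js /sub ks; apply: disj.
- by move=> j /sub js; apply: c0.
- by move=> j /sub js; apply: a0.
apply: Pdiv.ClosedField.root_coprimep => z; rewrite /root !hornerE => z1.
rewrite horner_prod prodf_seq_neq0; apply/allP => j js /=.
rewrite !hornerE subr_eq0 eq_sym; apply: (disj i j); rewrite ?mem_head ?sub //.
  by apply: contraNneq i_s => ->.
by move: z1; rewrite subr_eq0 eq_sym => /eqP.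
Qed.

Lemma size_prod_1subcXn (T : eqType) (s : seq T) (c : T -> C) (a : T -> nat) :
  {in s, forall i, (0 < a i)%N} -> {in s, forall i, c i != 0} ->
  size (\prod_(i <- s) (1 - c i *: 'X^(a i))) = (\sum_(i <- s) a i).+1.
Proof.
elim: s => [|i s IHs] a0 c0; first by rewrite !big_nil size_poly1.
have sub j : j \in s -> j \in i :: s by rewrite inE orbC => ->.
have n0 : {in i :: s, forall j, 1 - c j *: 'X^(a j) != 0}.
  by move=> j js; rewrite -size_poly_gt0 size_1subcXn ?a0 ?c0.
rewrite !big_cons size_mul ?n0 ?mem_head //; first last.
  by rewrite prodf_seq_neq0; apply/allP=> j /sub js /=; apply: n0.
rewrite size_1subcXn ?a0 ?c0 ?mem_head // IHs ?addnS //.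
  by move=> j /sub; apply: a0.
by move=> j /sub; apply: c0.
Qed.

Lemma dvdp_size_scale p q : p.[0] = 1 -> p %| q -> (size q <= size p)%N ->
  q = q.[0] *: p.
Proof.
move=> p1 /dvdpP[r ->] szq.
have p0 : p != 0 by apply/eqP => p0; move: p1; rewrite p0 horner0 => /eqP;
  rewrite eq_sym oner_eq0.
have [->|r0] := eqVneq r 0; first by rewrite mul0r horner0 scale0r.
move: szq; rewrite size_mul // -subn1 leq_subLR -[_.+1]addn1 leq_add2r => szr.
by rewrite (size1_polyC szr) mul_polyC hornerE p1 mulr1.
Qed.

Lemma mup_prod (T : eqType) z (s : seq T) (F : T -> {poly C}) :
  {in s, forall i, F i != 0} ->
  mup z (\prod_(i <- s) F i) = (\sum_(i <- s) mup z (F i))%N.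
Proof.
elim: s => [|i s IHs] F0; first by rewrite !big_nil mupNroot // root1.
have sub j : j \in s -> j \in i :: s by rewrite inE orbC => ->.
rewrite !big_cons mupM ?F0 ?mem_head //; first last.
  by rewrite prodf_seq_neq0; apply/allP=> j /sub js /=; apply: F0.
by rewrite IHs // => j /sub; apply: F0.
Qed.

Lemma mup_1subXn z n : (0 < n)%N -> mup z (1 - 'X^n) = (z ^+ n == 1).
Proof.
move=> n0; have := @separable_1subcXn 1 n n0 (oner_neq0 _).
rewrite scale1r => sep; have nz := separable_poly_neq0 sep.
case: (boolP (z ^+ n == 1)) => [zn|zn]; last first.
  by rewrite mupNroot // /root !hornerE subr_eq0 eq_sym.
apply/eqP; rewrite eqn_leq mup_leq // mup_geq // expr1 dvdp_XsubCl.
rewrite (separable_nosquare sep) ?size_XsubC //=.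
by rewrite /root !hornerE subr_eq0 eq_sym.
Qed.

(* With h = H + 1 and z^h = 1, the involution k |-> H - k exchanges the zeros
   at z of the factors 1 - X^k and of the factors 1 - X^(k+1); the remaining
   factor 1 - X^h on the right-hand side then forces W to vanish at z. *)
Lemma root_of_prod_1subXn (W : {poly C}) (ks : seq nat) (H : nat) z :
  (0 < H)%N -> all (fun k => 0 < k < H)%N ks ->
  perm_eq [seq (H - k)%N | k <- ks] ks ->
  W * (\prod_(k <- ks) (1 - 'X^k) * (1 - 'X^H)) =
    \prod_(k <- ks) (1 - 'X^(k.+1)) * (1 - 'X^(H.+1)) ->
  z ^+ H.+1 = 1 -> z != 1 -> root W z.
Proof.
move=> H0 /allP ksP sym eqW zh z1.
have n0 n : (0 < n)%N -> 1 - 'X^n != 0 :> {poly C}.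
  by move=> n0; rewrite -size_poly_gt0 -[_ ^+ n]scale1r size_1subcXn ?oner_neq0.
have [->|W0] := eqVneq W 0; first by rewrite root0.
have p0 (F : nat -> nat) : {in ks, forall k, 0 < F k}%N ->
    {in ks, forall k, 1 - 'X^(F k) != 0 :> {poly C}}.
  by move=> F0 k kks; apply/n0/F0.
have pr0 (F : nat -> nat) : {in ks, forall k, 0 < F k}%N ->
    \prod_(k <- ks) (1 - 'X^(F k)) != 0 :> {poly C}.
  by move=> F0; rewrite prodf_seq_neq0; apply/allP=> k /(p0 _ F0).
have k0 : {in ks, forall k, 0 < k}%N by move=> k /ksP /andP[].
have k1 : {in ks, forall k, 0 < k.+1}%N by [].
move/(congr1 (mup z)): eqW.
rewrite mupM ?mulf_neq0 ?(pr0 id) ?n0 //.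
rewrite mupM ?(pr0 id) ?n0 //.
rewrite mupM ?(pr0 succn) ?n0 //.
rewrite !mup_prod; [|exact: (p0 succn)|exact: (p0 id)].
rewrite !mup_1subXn // zh eqxx.
have -> : (\sum_(k <- ks) mup z (1 - 'X^k)%R =
    \sum_(k <- ks) mup z (1 - 'X^(k.+1))%R)%N.
  rewrite -(perm_big _ sym) /= big_map big_seq [RHS]big_seq.
  apply: eq_bigr => k kks; have /andP[kgt kH] := ksP _ kks.
  rewrite !mup_1subXn //; last by lia.
  congr nat_of_bool.
  have : z ^+ (H - k) * z ^+ k.+1 = 1.
    by rewrite -exprD -zh; congr (_ ^+ _); lia.
  by move=> zz; apply/eqP/eqP => e; move: zz; rewrite e ?mul1r ?mulr1.
have -> : (z ^+ H == 1) = false.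
  apply: contraNF z1 => /eqP zH.
  by rewrite -zh exprS zH mulr1.
rewrite addn0 addnC => /addnI muW.
by rewrite -dvdp_XsubCl XsubC_dvd // muW.
Qed.

Lemma palindromic_sum (s ks : seq nat) (m H : nat) :
  (m < H)%N -> all (fun l => l <= m)%N s ->
  all (fun k => 0 < k < H)%N ks -> perm_eq [seq (H - k)%N | k <- ks] ks ->
  (\sum_(l <- s) ('X^l + 'X^(m.*2.+1 - l))) *
    (\prod_(k <- ks) (1 - 'X^k) * (1 - 'X^H)) =
    \prod_(k <- ks) (1 - 'X^(k.+1)) * (1 - 'X^(H.+1)) :> {poly C} ->
  (\sum_(l <- s) ('X^l + 'X^(m.*2 - l)) - 'X^m *+ count_mem m s) *
    \prod_(k <- ks) (1 - 'X^k) = \prod_(k <- ks) (1 - 'X^(k.+1)) :> {poly C}.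
Proof.
move=> mH sm ksP sym.
set W := \sum_(l <- s) _; set M := \sum_(l <- s) _ => eqW.
pose G : {poly C} := \sum_(l <- s) ('X^(m - l) + 'X^(H - m + l)).
pose P : {poly C} := 1 - 'X^(H.+1).
have sepP : separable_poly P.
  by have := @separable_1subcXn 1 H.+1 isT (oner_neq0 _); rewrite scale1r.
have szP : size P = H.+2.
  by have := @size_1subcXn 1 H.+1 isT (oner_neq0 _); rewrite scale1r.
have GW : 'X^(m.+1) * G - W = - (\sum_(l <- s) 'X^l) * P.
  rewrite /G /W /P mulr_sumr -sumrB mulNr mulr_suml -sumrN.
  apply: eq_big_seq => l /(allP sm) lm.
  have -> : (m.*2.+1 - l = m.+1 + (m - l))%N by lia.
  rewrite mulrDr -!exprD mulrBr mulr1 -exprD.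
  have -> : (m.+1 + (H - m + l) = l + H.+1)%N by lia.
  by ring.
have rootG z : z ^+ H.+1 = 1 -> z != 1 -> root G z.
  move=> zh z1.
  have zn0 : z != 0.
    by apply/eqP => z0; move/eqP: zh; rewrite z0 expr0n /= eq_sym oner_eq0.
  have rW : root W z by apply: (root_of_prod_1subXn _ ksP sym eqW) => //; lia.
  have /(congr1 (horner^~ z)) := GW.
  rewrite !hornerE (rootP rW) zh subrr mulr0 subr0 => /eqP.
  by rewrite mulf_eq0 expf_eq0 (negPf zn0).
have G0 : G.[0] = (count_mem m s)%:R.
  rewrite /G horner_sum.
  rewrite (eq_big_seq (fun l => (m == l)%:R)) => [|l /(allP sm) lm].
    rewrite -natr_sum -sum1_count [in RHS]big_mkcond; congr _%:R.
    by apply: eq_bigr => l _; rewrite eq_sym /=; case: (l == m).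
  rewrite hornerD !hornerXn !expr0n.
  have -> : (m - l == 0)%N = (m == l) by apply/eqP/eqP; lia.
  have -> : (H - m + l == 0)%N = false by apply/eqP; lia.
  by rewrite addr0.
have szG : (size G <= H.+1)%N.
  apply: (leq_trans (size_sum _ _ _)); rewrite big_seq.
  apply: (big_ind (fun x => x <= H.+1)%N) => // [x y xH yH|l /(allP sm) lm].
    by rewrite geq_max xH.
  apply: (leq_trans (size_polyD _ _)); rewrite geq_max !size_polyXn.
  by apply/andP; split; lia.
have sz1X : size (1 - 'X : {poly C}) = 2.
  by rewrite -opprB size_polyN -[1]/(1%:P) size_XsubC.
have eqG : (1 - 'X) * G = P *+ count_mem m s.
  rewrite [LHS](@dvdp_size_scale P) //.
  - by rewrite hornerM G0 !hornerE subr0 mul1r scaler_nat.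
  - by rewrite /P !hornerE expr0n /= subr0.
  - apply: separable_dvdp => // z.
    rewrite /root /P !hornerE subr_eq0 eq_sym => /eqP zh.
    have [->|/(rootG z zh) /rootP ->] := eqVneq z 1; last by rewrite mulr0.
    by rewrite subrr mul0r.
  - rewrite szP; have [->|Gn0] := eqVneq G 0; first by rewrite mulr0 size_poly0.
    by rewrite size_mul -?size_poly_gt0 ?sz1X // size_poly_gt0.
have MW : P * M - (1 - 'X^H) * W = (1 - 'X) * ('X^m * G).
  rewrite /P /M /W /G !mulr_sumr -sumrB; apply: eq_big_seq => l /(allP sm) lm.
  have -> : (m.*2.+1 - l = (m - l) + ((m - l) + l).+1)%N by lia.
  have -> : (m.*2 - l = (m - l) + ((m - l) + l))%N by lia.
  have -> : 'X^m = 'X^(m - l) * 'X^l :> {poly C} by rewrite -exprD subnK.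
  have -> : 'X^(H.+1) = 'X * ('X^(H - m) * ('X^(m - l) * 'X^l)) :> {poly C}.
    by rewrite -!exprD -exprS; congr 'X^_; lia.
  have -> : 'X^H = 'X^(H - m) * ('X^(m - l) * 'X^l) :> {poly C}.
    by rewrite -!exprD; congr 'X^_; lia.
  rewrite !(exprS, exprD); ring.
have Pn0 : P != 0 by rewrite -size_poly_gt0 szP.
apply: (mulfI Pn0).
rewrite [RHS]mulrC -[RHS]eqW mulrA mulrBr.
have -> : P * M = (1 - 'X^H) * W + 'X^m * (P *+ count_mem m s).
  by rewrite -eqG mulrCA -MW addrC subrK.
by rewrite !mulrnAr ['X^m * P]mulrC addrK -mulrA mulrC -!mulrA.
Qed.

Lemma eq_poly_nat (p q : {poly C}) :
  (forall k, (1 < k)%N -> p.[k%:R] = q.[k%:R]) -> p = q.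
Proof.
move=> pq; apply/eqP; rewrite -subr_eq0; apply/eqP.
apply: (@roots_geq_poly_eq0 _ _ [seq k%:R | k <- iota 2 (size (p - q))]).
- apply/allP=> x /mapP[k]; rewrite mem_iota => /andP[k2 _] ->.
  by rewrite /root !hornerE pq // subrr.
- by rewrite map_inj_uniq ?iota_uniq // => i j /eqP; rewrite eqr_nat => /eqP.
- by rewrite size_map size_iota.
Qed.

End RootsOfPolynomials.

(** * Root systems *)

Section Reflections.

Variables (R : realType) (V : vectType R) (ip : {dot V for idfun}).
Implicit Types (a b u v x y : V).

Lemma ipC u v : ip u v = ip v u.
Proof. by rewrite (hermC ip) expr0 mul1r. Qed.

Lemma ipZl c u v : ip (c *: u) v = c * ip u v.
Proof. exact: linearZl_LR. Qed.

Lemma ipZr c u v : ip u (c *: v) = c * ip u v.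
Proof. by rewrite ipC ipZl ipC. Qed.

Lemma ip_gt0 u : u != 0 -> 0 < ip u u.
Proof. exact: neq0_dnorm_gt0. Qed.

Lemma ip_ge0 u : 0 <= ip u u.
Proof.
have [->|/ip_gt0/ltW //] := eqVneq u 0.
by rewrite linear0l.
Qed.

Lemma ip_le0_eq0 u : ip u u <= 0 -> u = 0.
Proof.
by move=> u0; apply/eqP; apply: contraLR u0 => /ip_gt0; rewrite -ltNge.
Qed.

Lemma ip_coroot a x : ip x (coroot ip a) = 2 * ip x a / ip a a.
Proof. by rewrite /coroot ipZr mulrAC. Qed.

Lemma reflectionD a x y :
  reflection ip a (x + y) = reflection ip a x + reflection ip a y.
Proof. by rewrite /reflection linearDl /= scalerDl opprD addrACA. Qed.

Lemma reflectionN a x : reflection ip a (- x) = - reflection ip a x.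
Proof. by rewrite /reflection linearNl /= scaleNr opprD. Qed.

Lemma reflectionB a x y :
  reflection ip a (x - y) = reflection ip a x - reflection ip a y.
Proof. by rewrite reflectionD reflectionN. Qed.

Lemma reflection_self a : a != 0 -> reflection ip a a = - a.
Proof.
move=> /ip_gt0 a0; rewrite /reflection ip_coroot mulfK ?gt_eqF //.
by rewrite scaler_nat mulr2n opprD addrA subrr sub0r.
Qed.

Lemma ip_reflection a x y : a != 0 ->
  ip (reflection ip a x) (reflection ip a y) = ip x y.
Proof.
move=> /ip_gt0 a0; rewrite /reflection !ip_coroot.
rewrite linearBl /= !linearBr /= !ipZl !ipZr (ipC a y).
by field; rewrite gt_eqF.
Qed.

Lemma reflectionK a : a != 0 -> involutive (reflection ip a).
Proof.
move=> /ip_gt0 a0 x; rewrite /reflection; set k := ip x _.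
rewrite linearBl /= ipZl (ip_coroot a a) mulfK ?gt_eqF //.
have -> : ip x (coroot ip a) - k * 2 = - k by rewrite -/k; ring.
by rewrite scaleNr opprK subrK.
Qed.

Lemma ip_reflectionl a x y : a != 0 ->
  ip (reflection ip a x) y = ip x (reflection ip a y).
Proof. by move=> a0; rewrite -(ip_reflection x _ a0) reflectionK. Qed.

Lemma reflection_isometry (w : V -> V) a x :
  {morph w : y z / y - z} -> (forall c y, w (c *: y) = c *: w y) ->
  (forall y z, ip (w y) (w z) = ip y z) ->
  reflection ip (w a) (w x) = w (reflection ip a x).
Proof.
by move=> wB wZ wip; rewrite /reflection !ip_coroot !wip wB wZ.
Qed.

Lemma sqr_ip_lt a b : b != 0 -> (forall c, a <> c *: b) ->
  ip a b ^+ 2 < ip a a * ip b b.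
Proof.
move=> /ip_gt0 b0 nab.
have u0 : ip b b *: a - ip a b *: b != 0.
  apply/eqP => /eqP; rewrite subr_eq0 => /eqP e.
  apply: (nab (ip a b / ip b b)).
  by rewrite mulrC -scalerA -e scalerA mulVf ?scale1r ?gt_eqF.
have := ip_gt0 u0.
rewrite linearBl /= !linearBr /= !ipZl !ipZr (ipC b a).
rewrite [X in 0 < X](_ : _ = ip b b * (ip a a * ip b b - ip a b ^+ 2));
  last by ring.
by rewrite pmulr_rgt0 // subr_gt0.
Qed.

End Reflections.

Section RootSystem.

Variables (R : realType) (V : vectType R) (ip : {dot V for idfun}).
Variables (Delta : {fset V}) (n : nat) (Pi : n.-tuple V) (theta : V).
Hypothesis hDelta : irreducible_root_system ip Delta.
Hypothesis hPi : simple_roots Delta Pi.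
Hypothesis htheta : highest_root Delta Pi theta.
Implicit Types (a b g v x y : V).

Local Notation s_ := (reflection ip).

Lemma root_neq0 a : a \in Delta -> a != 0.
Proof. by apply: contraTneq => ->; exact: roots_neq0 hDelta. Qed.

Lemma root_ip_gt0 a : a \in Delta -> 0 < ip a a.
Proof. by move=> /root_neq0 /ip_gt0. Qed.

Lemma reflection_root a b : a \in Delta -> b \in Delta -> s_ a b \in Delta.
Proof. exact: roots_reflection hDelta _ _. Qed.

Lemma opp_root a : a \in Delta -> - a \in Delta.
Proof.
move=> aD; rewrite -(reflection_self ip) ?root_neq0 //.
exact: reflection_root.
Qed.

Lemma opp_rootE a : (- a \in Delta) = (a \in Delta).
Proof. by apply/idP/idP => /opp_root; rewrite ?opprK. Qed.

Lemma reflection_rootE a b : a \in Delta -> (s_ a b \in Delta) = (b \in Delta).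
Proof.
move=> aD; apply/idP/idP => /(reflection_root aD) //.
by rewrite reflectionK // root_neq0.
Qed.

Lemma coroot_int a b : a \in Delta -> b \in Delta ->
  exists k : int, ip b (coroot ip a) = k%:~R.
Proof. by move=> aD bD; have /intrP := roots_int hDelta aD bD. Qed.

Lemma sub_root a b : a \in Delta -> b \in Delta -> 0 < ip a b -> a <> b ->
  a - b \in Delta.
Proof.
move=> aD bD ab nab.
have [p ep] := coroot_int bD aD; have [q eq] := coroot_int aD bD.
have a0 := root_ip_gt0 aD; have b0 := root_ip_gt0 bD.
have pgt : 0 < p by rewrite -(ltr0z R) -ep ip_coroot divr_gt0 // mulr_gt0.
have qgt : 0 < q.
  by rewrite -(ltr0z R) -eq ip_coroot divr_gt0 // mulr_gt0 // ipC.
have pq : p * q < 4.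
  rewrite -(ltr_int R) intrM -ep -eq !ip_coroot (ipC ip b a).
  rewrite [X in X < _](_ : _ = 4 * (ip a b ^+ 2 / (ip a a * ip b b)));
    last by field; rewrite !gt_eqF.
  rewrite gtr_pMr // ltr_pdivrMr ?mulr_gt0 // mul1r.
  apply: sqr_ip_lt; first exact: root_neq0.
  move=> c ea; case: (roots_reduced hDelta bD (c := c)); first by rewrite -ea.
    by move=> c1; apply: nab; rewrite ea c1 scale1r.
  move=> c1; move: ab; rewrite ea c1 scaleN1r linearNl /= oppr_gt0.
  by rewrite lt_gtF.
have [p1|q1] : p = 1 \/ q = 1 by nia.
  by have := reflection_root bD aD; rewrite /reflection ep p1 scale1r.
have := reflection_root aD bD; rewrite /reflection eq q1 scale1r.
by rewrite -opp_rootE opprB.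
Qed.

Definition hgt v : R := \sum_(i < n) coord Pi i v.

Lemma hgtD x y : hgt (x + y) = hgt x + hgt y.
Proof. by rewrite /hgt -big_split; apply: eq_bigr => i _; rewrite linearD. Qed.

Lemma hgtZ c x : hgt (c *: x) = c * hgt x.
Proof. by rewrite /hgt mulr_sumr; apply: eq_bigr => i _; rewrite linearZ. Qed.

Lemma hgtN x : hgt (- x) = - hgt x.
Proof. by rewrite -scaleN1r hgtZ mulN1r. Qed.

Lemma hgtB x y : hgt (x - y) = hgt x - hgt y.
Proof. by rewrite hgtD hgtN. Qed.

Lemma simple_root a : a \in Pi -> a \in Delta.
Proof. exact: (simple_sub hPi). Qed.

Lemma simple_span v : v = \sum_(i < n) coord Pi i v *: tnth Pi i.
Proof.
rewrite [LHS](coord_basis (simple_basis hPi) (memvf v)).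
by apply: eq_bigr => i _; rewrite -tnth_nth.
Qed.

Lemma coord_simple i j : coord Pi i (tnth Pi j) = (i == j)%:R.
Proof.
by rewrite (tnth_nth 0) coord_free ?(basis_free (simple_basis hPi)) ?[j == i]eq_sym.
Qed.

Lemma nonneg_comb_coord v : nonneg_comb Pi v ->
  forall i, exists k : nat, coord Pi i v = k%:R.
Proof.
case=> c -> i; exists (c (tnth Pi i)).
rewrite big_tuple linear_sum (bigD1 i) //= big1 => [|j ji].
  by rewrite linearMn /= coord_simple eqxx addr0.
by rewrite linearMn /= coord_simple eq_sym (negPf ji) mul0rn.
Qed.

Lemma nonneg_comb_hgt v : nonneg_comb Pi v -> 0 <= hgt v.
Proof.
move=> /nonneg_comb_coord vP; apply: sumr_ge0 => i _.
by have [k ->] := vP i; exact: ler0n.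
Qed.

Lemma nonneg_comb_hgt_eq0 v : nonneg_comb Pi v -> hgt v = 0 -> v = 0.
Proof.
move=> /nonneg_comb_coord vP /eqP; rewrite psumr_eq0 => [|i _]; last first.
  by have [k ->] := vP i.
move=> /allP v0; rewrite [v]simple_span big1 // => i _.
by rewrite (eqP (v0 i _)) ?mem_index_enum // scale0r.
Qed.

Lemma root_hgt_neq0 g : g \in Delta -> hgt g != 0.
Proof.
move=> gD; apply/eqP => g0; have := root_neq0 gD.
case: (simple_comb hPi gD) => /nonneg_comb_hgt_eq0.
  by move=> -> //; rewrite eqxx.
by rewrite hgtN g0 oppr0 -[g == 0]oppr_eq0 => -> //; rewrite eqxx.
Qed.

Lemma root_pos_or_neg g : g \in Delta -> 0 < hgt g \/ hgt g < 0.
Proof.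
by move=> /root_hgt_neq0; rewrite neq_lt => /orP[]; [right|left].
Qed.

Lemma hgt_gt0P g : g \in Delta -> 0 < hgt g -> nonneg_comb Pi g.
Proof.
move=> gD g0; case: (simple_comb hPi gD) => // /nonneg_comb_hgt.
by rewrite hgtN oppr_ge0 leNgt g0.
Qed.

Lemma pos_root_coord g i : g \in Delta -> 0 < hgt g ->
  exists k : nat, coord Pi i g = k%:R.
Proof. by move=> gD /(hgt_gt0P gD) /nonneg_comb_coord. Qed.

Lemma pos_root_coord_ge0 g i : g \in Delta -> 0 < hgt g -> 0 <= coord Pi i g.
Proof. by move=> gD g0; have [k ->] := pos_root_coord i gD g0. Qed.

Lemma coord_gt0_pos g i : g \in Delta -> 0 < coord Pi i g -> 0 < hgt g.
Proof.
move=> gD gi; case: (root_pos_or_neg gD) => // g0.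
have := @pos_root_coord_ge0 (- g) i; rewrite opp_rootE hgtN oppr_gt0.
by rewrite linearN oppr_ge0 leNgt gi => /(_ gD g0).
Qed.

Lemma hgt_simple a : a \in Pi -> hgt a = 1.
Proof.
case/tnthP => j ->; rewrite /hgt (bigD1 j) //= coord_simple eqxx big1 ?addr0 //.
by move=> i ij; rewrite coord_simple (negPf ij).
Qed.

Lemma pos_root_subZ g a c : g \in Delta -> 0 < hgt g -> a \in Pi -> g != a ->
  g - c *: a \in Delta -> 0 < hgt (g - c *: a).
Proof.
move=> gD g0 aPi ga gcD; have /tnthP[j aj] := aPi.
have [[i ij gi]|noi] : (exists2 i, i != j & 0 < coord Pi i g) \/
    forall i, i != j -> coord Pi i g = 0.
  have [/existsP[i /andP[ij gi]]|] :=
      boolP [exists i, (i != j) && (0 < coord Pi i g)]; first by left; exists i.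
  rewrite negb_exists => /forallP ngt; right=> i ij; have := ngt i.
  rewrite ij /= -leNgt => gi; apply: le_anti.
  by rewrite gi pos_root_coord_ge0.
  apply: (coord_gt0_pos (i := i)) => //.
  by rewrite linearB linearZ /= aj coord_simple (negPf ij) mulr0 subr0.
have eg : g = coord Pi j g *: a.
  by rewrite {1}[g]simple_span (bigD1 j) //= big1 ?addr0 -?aj // => i /noi ->;
    rewrite scale0r.
have [] := roots_reduced hDelta (simple_root aPi) (c := coord Pi j g);
  rewrite -?eg // => c1; move: eg; rewrite c1.
  by rewrite scale1r => eg; rewrite eg eqxx in ga.
by move=> eg; move: g0; rewrite eg hgtZ hgt_simple // mulr1 oppr_gt0 ltr10.
Qed.

Lemma reflection_pos_root g a : g \in Delta -> 0 < hgt g -> a \in Pi ->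
  g != a -> 0 < hgt (s_ a g).
Proof.
move=> gD g0 aPi ga; apply: pos_root_subZ => //.
by apply: reflection_root => //; exact: simple_root.
Qed.

Lemma hgt_reflection a g : a \in Pi ->
  hgt (s_ a g) = hgt g - ip g (coroot ip a).
Proof. by move=> aPi; rewrite /reflection hgtB hgtZ (hgt_simple aPi) mulr1. Qed.

Lemma ip_sum_coord g v : ip g v = \sum_(i < n) coord Pi i g * ip (tnth Pi i) v.
Proof.
rewrite {1}[g]simple_span linear_sumlz; apply: eq_bigr => i _.
by rewrite linearZl_LR.
Qed.

Lemma pos_root_ip_simple g : g \in Delta -> 0 < hgt g ->
  exists2 a, a \in Pi & 0 < ip g a.
Proof.
move=> gD g0; have gg := root_ip_gt0 gD.
have [/existsP[i gi]|] := boolP [exists i, 0 < ip g (tnth Pi i)].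
  by exists (tnth Pi i); rewrite ?mem_tnth.
rewrite negb_exists => /forallP nP; move: gg; rewrite ltNge => /negP[].
rewrite ip_sum_coord; apply: sumr_le0 => i _; rewrite mulr_ge0_le0 //.
  exact: pos_root_coord_ge0.
by rewrite ipC leNgt nP.
Qed.

Lemma hgt_ind (P : V -> Prop) :
  (forall g, g \in Delta ->
    (forall x, x \in Delta -> hgt g < hgt x -> P x) -> P g) ->
  forall g, g \in Delta -> P g.
Proof.
move=> IH g gD.
have [k] := ubnP #|` [fset x in Delta | hgt g < hgt x]|.
elim: k => // k IHk in g gD *; rewrite ltnS => szg.
apply: IH => // x xD gx; apply: IHk => //; apply: leq_trans szg.
apply: fproper_ltn_card; rewrite fproperE; apply/andP; split.
  by apply/fsubsetP => y; rewrite !inE => /andP[-> /(lt_trans gx)].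
by apply/negP => /fsubsetP /(_ x); rewrite !inE xD gx ltxx => /(_ isT).
Qed.

Lemma dominant_or_not g : {in Pi, forall a, 0 <= ip g a} \/
  exists2 a, a \in Pi & ip g a < 0.
Proof.
have [/allP dom|/allPn[a aPi]] := boolP (all (fun a => 0 <= ip g a) Pi).
  by left.
by rewrite -ltNge; right; exists a.
Qed.

Lemma dominant_ip_ge0 g v : {in Pi, forall a, 0 <= ip g a} ->
  nonneg_comb Pi v -> 0 <= ip g v.
Proof.
move=> dom [c ->]; rewrite linear_sumr big_seq; apply: sumr_ge0 => a aPi.
by rewrite linearMnr mulrn_wge0 // dom.
Qed.

Lemma theta_root : theta \in Delta. Proof. by case: htheta. Qed.

Lemma hgt_theta_max g : g \in Delta -> hgt g <= hgt theta.
Proof.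
move=> gD; rewrite -subr_ge0 -hgtB; apply: nonneg_comb_hgt.
by case: htheta => _; apply.
Qed.

Lemma hgt_theta_gt0 : 0 < hgt theta.
Proof.
have := hgt_theta_max (opp_root theta_root); rewrite hgtN => h.
by rewrite lt_def root_hgt_neq0 ?theta_root //=; lra.
Qed.

Lemma theta_dominant : {in Pi, forall a, 0 <= ip theta a}.
Proof.
move=> a aPi; rewrite leNgt; apply/negP => ta.
have aD := simple_root aPi.
have : theta - - a \in Delta.
  apply: sub_root => //; [exact: theta_root|exact: opp_root| |].
    by rewrite linearNr /= oppr_gt0.
  by move=> e; have := hgt_theta_gt0; rewrite e hgtN hgt_simple // ltr0N1.
by move/hgt_theta_max; rewrite opprK hgtD (hgt_simple aPi) gerDl ler10.
Qed.

Lemma pos_ip_theta g : g \in Delta -> 0 < hgt g -> 0 <= ip g theta.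
Proof.
move=> gD g0; rewrite ipC; apply: dominant_ip_ge0; first exact: theta_dominant.
exact: hgt_gt0P.
Qed.

Lemma ip_theta_gt0_pos g : g \in Delta -> 0 < ip g theta -> 0 < hgt g.
Proof.
move=> gD gt; case: (root_pos_or_neg gD) => // g0.
have := @pos_ip_theta (- g); rewrite opp_rootE hgtN oppr_gt0 => /(_ gD g0).
by rewrite linearNl /= oppr_ge0 leNgt gt.
Qed.

Lemma dominant_root_norm g : g \in Delta -> {in Pi, forall a, 0 <= ip g a} ->
  ip g g <= ip g theta <= ip theta theta.
Proof.
move=> gD dom; have cmb : nonneg_comb Pi (theta - g) by case: htheta => _; apply.
have := dominant_ip_ge0 dom cmb; have := dominant_ip_ge0 theta_dominant cmb.
by rewrite !linearBr /= !subr_ge0 (ipC ip theta g) => -> ->.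
Qed.

Lemma root_norm_le g : g \in Delta -> ip g g <= ip theta theta.
Proof.
move: g; apply: hgt_ind => g gD IH; have [dom|[a aPi ga]] := dominant_or_not g.
  by have /andP[] := dominant_root_norm gD dom; apply: le_trans.
have aD := simple_root aPi; have a0 := root_neq0 aD.
rewrite -(ip_reflection ip g g a0); apply: IH; first exact: reflection_root.
rewrite hgt_reflection // ltrDl oppr_gt0 ip_coroot -mulrA pmulr_rlt0 //.
by rewrite pmulr_llt0 // invr_gt0 root_ip_gt0.
Qed.

Definition long : {fset V} := [fset b in Delta | ip b b == ip theta theta].

Lemma longP b : reflect (b \in Delta /\ ip b b = ip theta theta) (b \in long).
Proof. by rewrite !inE /=; apply: (iffP andP) => -[bD /eqP]. Qed.

Lemma theta_long : theta \in long.
Proof. by apply/longP; split=> //; exact: theta_root. Qed.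

Lemma dominant_long b : b \in long -> {in Pi, forall a, 0 <= ip b a} ->
  b = theta.
Proof.
move=> /longP[bD bb] dom; apply/eqP; rewrite -subr_eq0; apply/eqP.
apply: (ip_le0_eq0 (ip := ip)).
have /andP[] := dominant_root_norm bD dom.
by rewrite linearBl /= !linearBr /= (ipC ip theta b) bb => h1 h2; lra.
Qed.

Lemma long_coroot_le2 b g : b \in long -> g \in Delta ->
  ip g (coroot ip b) <= 2 ?= iff (g == b).
Proof.
move=> /longP[bD bb] gD; have b0 := root_ip_gt0 bD; have gg := root_norm_le gD.
have : 0 <= ip (g - b) (g - b) by exact: ip_ge0.
rewrite linearBl /= !linearBr /= (ipC ip b g) => h.
split; first by rewrite ip_coroot ler_pdivrMr //; lra.
apply/eqP/eqP => [e|->]; last by rewrite ip_coroot mulfK // gt_eqF.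
apply/eqP; rewrite -subr_eq0; apply/eqP; apply: (ip_le0_eq0 (ip := ip)).
move: e; rewrite ip_coroot => /(canRL (divfK (lt0r_neq0 b0))) e.
by rewrite linearBl /= !linearBr /= (ipC ip b g); lra.
Qed.

Local Notation tv := (coroot ip theta).
Local Notation Delta1 := (Delta_ ip Delta theta 1).

Lemma Delta1P g : reflect (g \in Delta /\ ip g tv = 1) (g \in Delta1).
Proof. by rewrite !inE /=; apply: (iffP andP) => -[gD /eqP]. Qed.

Lemma ip_tv_theta : ip theta tv = 2.
Proof. by rewrite ip_coroot mulfK // gt_eqF // root_ip_gt0 // theta_root. Qed.

Lemma ip_tv_gt0 v : (0 < ip v tv) = (0 < ip v theta).
Proof.
have t0 := root_ip_gt0 theta_root.
by rewrite ip_coroot -mulrA pmulr_rgt0 // pmulr_lgt0 // invr_gt0.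
Qed.

Lemma degreeP g : g \in Delta ->
  g = theta \/ g \in Delta1 \/ ip g tv = 0 \/ - g \in Delta1 \/ g = - theta.
Proof.
move=> gD; have [k ek] := coroot_int theta_root gD.
have [k2 k2e] := long_coroot_le2 theta_long gD.
have [k3 k3e] := long_coroot_le2 theta_long (opp_root gD).
move: k2 k3; rewrite linearNl /= ek -mulrNz !(ler_int _ _ 2) => k2 k3.
have [|[|[|[|]]]] : k = 2 \/ k = 1 \/ k = 0 \/ k = -1 \/ k = -2 by lia.
- by move=> e; left; apply/eqP; rewrite -k2e ek e.
- by move=> e; right; left; apply/Delta1P; rewrite ek e.
- by move=> e; right; right; left; rewrite e.
- move=> e; do 3!right; left; apply/Delta1P; rewrite opp_rootE gD.
  by rewrite linearNl /= ek e mulrNz opprK.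
- move=> e; do 4!right; apply/eqP.
  by rewrite -eqr_oppLR -k3e linearNl /= ek e mulrNz opprK.
Qed.

Lemma positive_degreeP g : g \in Delta -> 0 < ip g tv ->
  g = theta \/ g \in Delta1.
Proof.
move=> gD; case: (degreeP gD) => [->|[gD1|[->|[/Delta1P[_]|->]]]]; [by left|..].
- by right.
- by rewrite ltxx.
- by rewrite linearNl => /eqP; rewrite eqr_oppLR => /eqP ->; rewrite ltr0N1.
- by rewrite linearNl /= ip_tv_theta oppr_gt0 ltrn0.
Qed.

Lemma Delta1_root g : g \in Delta1 -> g \in Delta.
Proof. by case/Delta1P. Qed.

Lemma Delta1_pos g : g \in Delta1 -> 0 < hgt g.
Proof.
by case/Delta1P=> gD g1; apply: ip_theta_gt0_pos => //; rewrite -ip_tv_gt0 g1.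
Qed.

Lemma theta_sub_Delta1 g : g \in Delta1 -> theta - g \in Delta1.
Proof.
case/Delta1P=> gD g1; apply/Delta1P; split; last first.
  by rewrite linearBl /= ip_tv_theta g1; lra.
apply: sub_root => //; first exact: theta_root.
  by rewrite ipC -ip_tv_gt0 g1.
by move=> e; move: g1; rewrite -e ip_tv_theta => /eqP; rewrite (eqr_nat _ 2 1).
Qed.

Lemma theta_sub_Delta1E g : (theta - g \in Delta1) = (g \in Delta1).
Proof.
by apply/idP/idP => /theta_sub_Delta1; rewrite // opprB addrC subrK.
Qed.

Lemma theta_sub_neq g : g \in Delta1 -> theta - g != g.
Proof.
move=> gD1; apply/eqP => e; have gD := Delta1_root gD1.
have e2 : theta = 2 *: g by rewrite scaler_nat mulr2n -{1}e subrK.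
have := theta_root; rewrite e2 => /(roots_reduced hDelta gD) [/eqP|h].
  by rewrite (eqr_nat _ 2 1).
by have := ltr0n R 2; rewrite h ltr0N1.
Qed.

Lemma theta_notin_Delta1 : theta \notin Delta1.
Proof.
apply/negP => /Delta1P[_]; rewrite ip_tv_theta => /eqP.
by rewrite (eqr_nat _ 2 1).
Qed.

Definition act (s : seq V) x := foldr s_ x s.

Lemma act_rcons s a x : act (rcons s a) x = act s (s_ a x).
Proof. by rewrite /act foldr_rcons. Qed.

Lemma act_cat s s' x : act (s ++ s') x = act s (act s' x).
Proof. by rewrite /act foldr_cat. Qed.

Lemma actB s : {morph act s : x y / x - y}.
Proof. by move=> x y; elim: s => //= a s ->; rewrite reflectionB. Qed.

Lemma actZ s c x : act s (c *: x) = c *: act s x.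
Proof.
elim: s => //= a s ->.
by rewrite /reflection ipZl scalerBr scalerA.
Qed.

Lemma actN s x : act s (- x) = - act s x.
Proof. by rewrite -scaleN1r actZ scaleN1r. Qed.

Lemma actD s x y : act s (x + y) = act s x + act s y.
Proof. by rewrite -[y]opprK actB actN !opprK. Qed.

Lemma act_ip s x y : {subset s <= Pi} -> ip (act s x) (act s y) = ip x y.
Proof.
elim: s => //= a s IHs sPi.
have aPi : a \in Pi by apply: sPi; rewrite mem_head.
rewrite ip_reflection ?(root_neq0 (simple_root aPi)) // IHs // => b bs.
by apply: sPi; rewrite inE bs orbT.
Qed.

Lemma act_rootE s x : {subset s <= Pi} -> (act s x \in Delta) = (x \in Delta).
Proof.
elim: s => //= a s IHs sPi.
have aPi : a \in Pi by apply: sPi; rewrite mem_head.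
rewrite reflection_rootE ?(simple_root aPi) // -/(act s x) IHs // => b bs.
by apply: sPi; rewrite inE bs orbT.
Qed.

Lemma actK s x : {subset s <= Pi} -> act (rev s) (act s x) = x.
Proof.
elim: s => //= a s IHs sPi.
have aPi : a \in Pi by apply: sPi; rewrite mem_head.
rewrite rev_cons act_rcons reflectionK ?(root_neq0 (simple_root aPi)) // IHs //.
by move=> b bs; apply: sPi; rewrite inE bs orbT.
Qed.

Lemma sub_rev s : {subset s <= Pi} -> {subset rev s <= Pi}.
Proof. by move=> sPi b; rewrite mem_rev; exact: sPi. Qed.

Lemma actVK s x : {subset s <= Pi} -> act s (act (rev s) x) = x.
Proof. by move=> sPi; rewrite -{1}[s]revK actK //; exact: sub_rev. Qed.

Lemma exchange s a : {subset s <= Pi} -> a \in Pi -> hgt (act s a) < 0 ->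
  exists s', [/\ {subset s' <= Pi}, size s = (size s').+1 &
    forall x, act s (s_ a x) = act s' x].
Proof.
move=> + aPi; have aD := simple_root aPi.
elim: s => [|b s IHs] sPi /=; first by rewrite hgt_simple // ltr10.
have bPi : b \in Pi by apply: sPi; rewrite mem_head.
have {}sPi : {subset s <= Pi} by move=> c cs; apply: sPi; rewrite inE cs orbT.
have saD : act s a \in Delta by rewrite act_rootE.
move=> neg; case: (root_pos_or_neg saD) => [pos|]; last first.
  case/(IHs sPi) => s' [s'Pi sz e]; exists (b :: s'); split=> //=.
  - by move=> c; rewrite inE => /orP[/eqP-> //|]; exact: s'Pi.
  - by rewrite sz.
  - by move=> x; rewrite e.
exists s; split=> // x.
have eb : b = act s a.
  apply/eqP; apply: contraTT neg; rewrite eq_sym => nb.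
  by rewrite -leNgt ltW // reflection_pos_root.
rewrite eb reflection_isometry ?reflectionK ?(root_neq0 aD) //.
- exact: actB.
- exact: actZ.
- by move=> y z; rewrite act_ip.
Qed.

Lemma act_pos_id s : {subset s <= Pi} ->
  (forall g, g \in Delta -> 0 < hgt g -> 0 < hgt (act s g)) ->
  forall x, act s x = x.
Proof.
have [k] := ubnP (size s); elim: k => // k IHk in s *.
case/lastP: s => [//|s a]; rewrite size_rcons ltnS => szs sPi pos.
have aPi : a \in Pi by apply: sPi; rewrite mem_rcons mem_head.
have {}sPi : {subset s <= Pi}.
  by move=> c cs; apply: sPi; rewrite mem_rcons inE cs orbT.
have aD := simple_root aPi.
have : hgt (act s a) < 0.
  have := pos a aD; rewrite hgt_simple // act_rcons reflection_self ?root_neq0 //.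
  by rewrite actN hgtN oppr_gt0; apply.
case/(exchange sPi aPi) => s' [s'Pi sz e] x; rewrite act_rcons e.
apply: IHk => // [|g gD g0]; first by apply: leq_trans szs; rewrite sz.
by rewrite -e -act_rcons; apply: pos.
Qed.

(** * Upper ideals and long roots *)

Local Notation S0 := (Pi0 ip Delta Pi theta).
Local Notation upper := (upper_ideal Delta1 S0).

Lemma mem_Pi0 a : (a \in S0) = (a \in Pi) && (ip a tv == 0).
Proof.
rewrite mem_filter andbC !inE /=.
by have [/simple_root -> //|] := boolP (a \in Pi).
Qed.

Lemma nonneg_comb_Pi0 v : nonneg_comb S0 v -> nonneg_comb Pi v.
Proof.
case=> c ->; exists (fun a => if a \in Delta_ ip Delta theta 0 then c a else 0).
rewrite /Pi0 big_filter big_mkcond; apply: eq_bigr => a _.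
by case: ifP; rewrite ?mulr0n.
Qed.

Lemma pos_root_comb_Pi0 g : g \in Delta -> 0 < hgt g -> ip g tv = 0 ->
  nonneg_comb S0 g.
Proof.
move=> gD g0 gt; have [c ec] := hgt_gt0P gD g0; exists c.
have t0 := root_ip_gt0 theta_root.
have tv_ge0 a : a \in Pi -> 0 <= ip a tv.
  move=> aPi; rewrite ip_coroot divr_ge0 ?(ltW t0) // mulr_ge0 // ipC.
  exact: theta_dominant.
have sum0 : \sum_(a <- Pi) ip a tv *+ c a = 0.
  rewrite -[RHS]gt [in RHS]ec linear_sumlz; apply: eq_bigr => a _.
  by rewrite linearMnl.
rewrite /Pi0 big_filter {1}ec [RHS]big_mkcond; apply: eq_big_seq => a aPi.
case: ifPn => //; rewrite !inE simple_root //= => at0.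
move/eqP: sum0; rewrite big_seq psumr_eq0 => [|b bPi]; last first.
  by rewrite mulrn_wge0 // tv_ge0.
move=> /allP /(_ a aPi); rewrite aPi /= mulrn_eq0 (negPf at0) orbF => /eqP ->.
by rewrite mulr0n.
Qed.

Lemma preceq_hgt m g : preceq S0 m g -> hgt m <= hgt g.
Proof. by move=> /nonneg_comb_Pi0 /nonneg_comb_hgt; rewrite hgtB subr_ge0. Qed.

Lemma preceq_sub m g h k : g - m = h - k -> preceq S0 m g -> preceq S0 k h.
Proof. by rewrite /preceq => ->. Qed.

(* Encodes an element w of the Weyl group, given by a word, such that w is of
   minimal length in its coset modulo the stabiliser of theta and w theta is
   positive. *)
Definition minimal_word s := [/\ {subset s <= Pi},
  forall g, g \in Delta -> ip g tv = 0 -> 0 < hgt g -> 0 < hgt (act s g) &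
  0 < hgt (act s theta)].

(* The inversion set of the word s is {theta - g | g in inv_ideal s}. *)
Definition inv_ideal s : {fset V} :=
  [fset g in Delta1 | hgt (act s (theta - g)) < 0].

Lemma inv_idealP s g :
  reflect (g \in Delta1 /\ hgt (act s (theta - g)) < 0) (g \in inv_ideal s).
Proof.
by rewrite !inE /=; apply: (iffP andP) => -[gD1 g0]; split; rewrite ?inE // -?inE.
Qed.

Lemma inv_ideal_sub s : inv_ideal s `<=` Delta1.
Proof. by apply/fsubsetP => g /inv_idealP[]. Qed.

Definition antipode_free (I : {fset V}) : bool :=
  all (fun g => theta - g \notin I) I.

Lemma antipode_freeP (I : {fset V}) :
  reflect (forall g, g \in I -> theta - g \notin I) (antipode_free I).
Proof. exact: allP. Qed.

Lemma act_inj s : {subset s <= Pi} -> injective (act s).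
Proof. by move=> sPi; apply: (can_inj (g := act (rev s))) => x; apply: actK. Qed.

Lemma act_pos_or_neg s g : {subset s <= Pi} -> g \in Delta ->
  0 < hgt (act s g) \/ hgt (act s g) < 0.
Proof. by move=> sPi gD; apply: root_pos_or_neg; rewrite act_rootE. Qed.

Lemma inv_ideal_upper s : minimal_word s -> upper (inv_ideal s).
Proof.
case=> sPi s0 _; split; first exact: inv_ideal_sub.
move=> m g /inv_idealP[mD1 m0] gD1 [c ec]; apply/inv_idealP; split=> //.
have -> : theta - g = (theta - m) - (g - m).
  by rewrite opprB addrA subrK.
rewrite actB hgtB; apply: (le_lt_trans _ m0); rewrite gerBl ec big_seq.
apply: (big_ind (fun v => 0 <= hgt (act s v))).
- by rewrite -(scale0r 0) actZ hgtZ mul0r.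
- by move=> x y x0 y0; rewrite actD hgtD addr_ge0.
move=> a; rewrite mem_Pi0 => /andP[aPi /eqP at0].
rewrite -scaler_nat actZ hgtZ mulr_ge0 // ltW // s0 ?simple_root //.
by rewrite hgt_simple.
Qed.

Lemma inv_ideal_antipode_free s : minimal_word s -> antipode_free (inv_ideal s).
Proof.
case=> sPi _ st; apply/antipode_freeP => g /inv_idealP[gD1 g0].
apply/negP => /inv_idealP[_]; rewrite opprB addrCA subrr addr0 => g0'.
move: st; rewrite -(subrK g theta) actD hgtD => h.
by have := ltrD g0 g0'; rewrite addr0 => /(lt_trans h); rewrite ltxx.
Qed.

Lemma minimal_word_nil : minimal_word [::].
Proof. by split=> //; exact: hgt_theta_gt0. Qed.

Lemma inv_ideal_nil : inv_ideal [::] = fset0.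
Proof.
apply/fsetP => g; rewrite inE; apply/negP => /inv_idealP[].
by rewrite -theta_sub_Delta1E => /Delta1_pos /= gt /(lt_trans gt); rewrite ltxx.
Qed.

Lemma minimal_word_cons s g a : minimal_word s -> g \in Delta1 -> a \in Pi ->
  act s (theta - g) = a ->
  [/\ minimal_word (a :: s), inv_ideal (a :: s) = g |` inv_ideal s &
      hgt (act (a :: s) theta) <= hgt (act s theta) - 1].
Proof.
case=> sPi s0 st gD1 aPi ea; have aD := simple_root aPi.
have [tgD tg1] := Delta1P _ (theta_sub_Delta1 gD1).
have [gD g1] := Delta1P _ gD1.
have asPi : {subset a :: s <= Pi}.
  by move=> c; rewrite inE => /orP[/eqP ->|/sPi].
split.
- split=> //= [x xD xt x0|].
    apply: reflection_pos_root; rewrite ?act_rootE ?s0 //.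
    apply/eqP; rewrite -ea => /(act_inj sPi) e; move: xt; rewrite e tg1 => /eqP.
    by rewrite oner_eq0.
  apply: reflection_pos_root; rewrite ?act_rootE ?theta_root //.
  rewrite -ea; apply/eqP => /(act_inj sPi) e; move: tg1; rewrite -e ip_tv_theta.
  by move/eqP; rewrite (eqr_nat _ 2 1).
- apply/fsetP => x; rewrite in_fset1U; apply/inv_idealP/orP => /=.
    case=> xD1 h; have xD := Delta1_root (theta_sub_Delta1 xD1).
    have [->|xg] := eqVneq x g; [by left|right].
    apply/inv_idealP; split=> //.
    have [pos|//] := act_pos_or_neg sPi xD.
    move: h; rewrite ltNge ltW // reflection_pos_root ?act_rootE //.
    rewrite -ea; apply: contra_neq xg => /(act_inj sPi) /addrI /oppr_inj.
    by [].
  case=> [/eqP ->|/inv_idealP[xD1 h]].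
    split=> //; rewrite -/(act s _) ea reflection_self ?root_neq0 //.
    by rewrite hgtN hgt_simple // oppr_lt0.
  split=> //; rewrite -oppr_gt0 -hgtN -reflectionN -actN opprB.
  have [xD x1] := Delta1P _ (theta_sub_Delta1 xD1).
  have xD' : x - theta \in Delta by rewrite -opp_rootE opprB.
  apply: reflection_pos_root; rewrite ?act_rootE //.
    by rewrite -opprB actN hgtN oppr_gt0.
  rewrite -ea; apply/eqP => /(act_inj sPi) e.
  have : ip (theta - x) tv = - ip (theta - g) tv.
    by rewrite -e -(opprB x theta) linearNl.
  by rewrite x1 tg1 => h1; have := @ltr01 R; rewrite h1 ltr0N1.
rewrite /= hgt_reflection // lerD2l lerN2.
have [k ek] : exists k : int, ip (act s theta) (coroot ip a) = k%:~R.
  by apply: coroot_int; rewrite ?act_rootE // theta_root.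
rewrite -/(act s _) ek ler1z -gtz0_ge1 -(ltr0z R) -ek ip_coroot.
rewrite divr_gt0 ?root_ip_gt0 // mulr_gt0 // -ea act_ip // ipC.
by rewrite -ip_tv_gt0 tg1.
Qed.

Lemma theta_sub_shift g x : g \in Delta1 -> x \in Delta -> ip x tv = 0 ->
  theta - g - x \in Delta -> g + x \in Delta1.
Proof.
case/Delta1P=> gD g1 xD x0 txD; rewrite -theta_sub_Delta1E opprD addrA.
apply/Delta1P; split=> //.
by rewrite !linearBl /= ip_tv_theta g1 x0; ring.
Qed.

Lemma simple_of_maximal_ideal s I g :
  minimal_word s -> upper I -> antipode_free I -> g \in I ->
  inv_ideal s = I `\ g -> act s (theta - g) \in Pi.
Proof.
move=> gs [ID upI] /antipode_freeP afI gI eN; have [sPi s0 st] := gs.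
have gD1 : g \in Delta1 by apply: (fsubsetP ID).
have [tgD tg1] := Delta1P _ (theta_sub_Delta1 gD1).
have bD : act s (theta - g) \in Delta by rewrite act_rootE.
have b0 : 0 < hgt (act s (theta - g)).
  have [//|neg] := act_pos_or_neg sPi tgD.
  have : g \in inv_ideal s by apply/inv_idealP.
  by rewrite eN !inE eqxx.
(* A decomposition theta - g = m + v into roots made positive by s is
   impossible: either it exhibits an element of the ideal above g, or it
   involves theta itself and g would be in the ideal together with theta - g. *)
have nosplit m v : m \in Delta -> v \in Delta -> m + v = theta - g ->
    0 < hgt (act s m) -> 0 < hgt (act s v) -> ip m tv = 0 -> False.
  move=> mD vD emv m0 v0 mt.
  have mp : 0 < hgt m.
    have [//|mn] := root_pos_or_neg mD.
    have := s0 (- m); rewrite opp_rootE linearNl /= mt oppr0 hgtN oppr_gt0.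
    by move=> /(_ mD erefl mn); rewrite actN hgtN oppr_gt0 => /(lt_trans m0);
      rewrite ltxx.
  have ev : theta - g - m = v by rewrite -emv addrAC subrr add0r.
  have gmD1 : g + m \in Delta1 by apply: theta_sub_shift; rewrite ?ev.
  have gmI : g + m \in I.
    apply: upI gI gmD1 _; rewrite /preceq addrAC subrr add0r.
    exact: pos_root_comb_Pi0.
  have : g + m \in inv_ideal s.
    rewrite eN !inE gmI andbT -subr_eq0 addrAC subrr add0r.
    exact: root_neq0.
  case/inv_idealP => _; rewrite opprD addrA ev => /(lt_trans v0).
  by rewrite ltxx.
have nosplit2 v : v \in Delta -> theta + v = theta - g ->
    0 < hgt (act s v) -> False.
  move=> vD /addrI ev; rewrite ev actN hgtN oppr_gt0 => v0.
  have : theta - g \in inv_ideal s.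
    apply/inv_idealP; split; first by rewrite theta_sub_Delta1E.
    by rewrite opprB addrCA subrr addr0.
  by rewrite eN !inE (negPf (afI _ gI)) andbF.
have [a aPi ba] := pos_root_ip_simple bD b0; have aD := simple_root aPi.
have [<- //|nab] := eqVneq a (act s (theta - g)).
have subD : act s (theta - g) - a \in Delta.
  by apply: sub_root => //; apply/eqP; rewrite eq_sym.
have sub0 : 0 < hgt (act s (theta - g) - a).
  have := @pos_root_subZ (act s (theta - g)) a 1; rewrite scale1r; apply=> //.
  by rewrite eq_sym.
pose v := act (rev s) a; pose m := theta - g - v.
have ev : act s v = a by rewrite /v actVK.
have em : act s m = act s (theta - g) - a by rewrite /m actB ev.
have vD : v \in Delta by rewrite -(act_rootE v sPi) ev.
have mD : m \in Delta by rewrite -(act_rootE m sPi) em.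
have emv : m + v = theta - g by rewrite /m subrK.
have degs : ip m tv + ip v tv = 1 by move: tg1; rewrite -{1}emv linearDl.
have v0 : 0 < hgt (act s v) by rewrite ev hgt_simple.
have m0 : 0 < hgt (act s m) by rewrite em.
have le2 x : x \in Delta -> ip x tv <= 2.
  by move=> xD; have [] := long_coroot_le2 theta_long xD.
case: (degreeP mD) => [et|[mD1|[mt|[mD1|et]]]].
- by case: (nosplit2 v) => //; rewrite -emv et.
- case: (nosplit v m) => //; first by rewrite addrC.
  by case/Delta1P: mD1 degs => _ -> h; lra.
- by case: (nosplit m v).
- case: (nosplit2 m) => //; rewrite -emv addrC; congr (_ + _).
  apply/esym/eqP; have [_ <-] := long_coroot_le2 theta_long vD.
  by case/Delta1P: mD1 => _; rewrite linearNl /= => h; apply/eqP; lra.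
- have := le2 v vD; move: degs; rewrite et linearNl /= ip_tv_theta => h1 h2.
  suff : (0 : R) < 0 by rewrite ltxx.
  by lra.
Qed.

Lemma preceq_antisym m g : preceq S0 m g -> hgt g <= hgt m -> m = g.
Proof.
move=> mg gm; apply/eqP; rewrite eq_sym -subr_eq0; apply/eqP.
apply: nonneg_comb_hgt_eq0; first exact: nonneg_comb_Pi0.
by rewrite hgtB; apply/eqP; rewrite subr_eq0 eq_le gm preceq_hgt.
Qed.

Lemma min_hgt (I : {fset V}) : I != fset0 ->
  exists2 g, g \in I & forall x, x \in I -> hgt g <= hgt x.
Proof.
case/fset0Pn => x0 x0I.
pose y0 : I := [` x0I]%fset.
case: (Order.TotalTheory.arg_minP (fun x : I => hgt (val x)) (isT : predT y0)).
move=> g _ gmin; exists (val g); first exact: valP.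
by move=> x xI; have := gmin [` xI]%fset isT.
Qed.

Lemma ideal_word I : upper I -> antipode_free I ->
  exists s, [/\ minimal_word s, inv_ideal s = I &
    #|` I|%:R + hgt (act s theta) <= hgt theta].
Proof.
have [k] := ubnP #|` I|; elim: k => // k IHk in I *; rewrite ltnS => szI upI afI.
have [I0|I0] := eqVneq I fset0.
  exists [::]; split; [exact: minimal_word_nil| |].
    by rewrite inv_ideal_nil I0.
  by rewrite I0 cardfs0 add0r.
have [g gI gmin] := min_hgt I0; have [ID upI'] := upI.
have gD1 : g \in Delta1 by apply: (fsubsetP ID).
have cI : #|` I| = (#|` I `\ g|).+1 by rewrite (cardfsD1 g) gI.
have upg : upper (I `\ g).
  split; first exact: fsubset_trans (fsubD1set _ _) ID.
  move=> m x; rewrite !in_fsetD1 => /andP[mg mI] xD1 mx.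
  rewrite (upI' _ _ mI) // andbT; apply: contra_neq mg => xg.
  by rewrite -xg; apply: preceq_antisym => //; rewrite xg gmin.
have afg : antipode_free (I `\ g).
  apply/antipode_freeP => x; rewrite !in_fsetD1 => /andP[_ xI].
  by rewrite negb_and (antipode_freeP _ afI) ?orbT.
have [|s [gs eN le]] := IHk _ _ upg afg; first by rewrite -ltnS -cI ltnS.
have aPi := simple_of_maximal_ideal gs upI afI gI eN.
have [gas eNa lea] := minimal_word_cons gs gD1 aPi erefl.
exists (act s (theta - g) :: s); split=> //.
  by rewrite eNa eN fsetD1K.
apply: le_trans le; rewrite cI -addn1 natrD -addrA lerD2l.
by rewrite -lerBrDl.
Qed.

Lemma reflection_long a b : a \in Delta -> b \in long -> s_ a b \in long.
Proof.
move=> aD /longP[bD bb]; apply/longP.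
by rewrite reflection_rootE // ip_reflection // root_neq0.
Qed.

Lemma long_word b : b \in long -> 0 < hgt b ->
  exists2 s, minimal_word s & act s theta = b.
Proof.
move=> bl b0; have /longP[bD _] := bl; move: b bD bl b0.
apply: hgt_ind => b bD IH bl b0; have [dom|[a aPi ba]] := dominant_or_not b.
  by exists [::]; rewrite ?(dominant_long bl dom) //; exact: minimal_word_nil.
have aD := simple_root aPi.
have hb : hgt b < hgt (s_ a b).
  rewrite hgt_reflection // ltrDl oppr_gt0 ip_coroot -mulrA pmulr_rlt0 //.
  by rewrite pmulr_llt0 // invr_gt0 root_ip_gt0.
have [||s gs es] := IH (s_ a b) _ hb _ (lt_trans b0 hb).
- by rewrite reflection_rootE.
- exact: reflection_long.
have [sPi _ _] := gs.
pose x := act (rev s) a.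
have ex : act s x = a by rewrite actVK.
have xD : x \in Delta by rewrite -(act_rootE x sPi) ex.
have tx : 0 < ip x tv.
  rewrite ip_tv_gt0 -(act_ip x theta sPi) ex es ipC ip_reflectionl ?root_neq0 //.
  by rewrite reflection_self ?root_neq0 // linearNr oppr_gt0.
have xD1 : x \in Delta1.
  have [et|//] := positive_degreeP xD tx.
  have eb : b = - a.
    by rewrite -(reflectionK ip (root_neq0 aD) b) -es -et ex reflection_self
      ?root_neq0.
  by move: b0; rewrite eb hgtN hgt_simple // ltr0N1.
have [] := @minimal_word_cons s (theta - x) a gs _ aPi.
- by rewrite theta_sub_Delta1E.
- by rewrite opprB addrCA subrr addr0.
move=> gas _ _; exists (a :: s) => //=.
by rewrite -/(act s theta) es reflectionK // root_neq0.
Qed.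

Lemma act_id_subset s s' : {subset s <= Pi} -> {subset s' <= Pi} ->
  (forall g, g \in Delta -> 0 < hgt (act s g) -> 0 < hgt (act s' g)) ->
  act s =1 act s'.
Proof.
move=> sPi s'Pi pos x.
have -> : act s' x = act (s' ++ rev s) (act s x).
  by rewrite act_cat actK.
symmetry; apply: act_pos_id => [c|g gD g0].
  by rewrite mem_cat => /orP[/s'Pi|/(sub_rev sPi)].
have := pos (act (rev s) g); rewrite act_rootE ?actVK //; last exact: sub_rev.
by move=> /(_ gD g0); rewrite act_cat.
Qed.

Lemma inv_ideal_inj s s' : minimal_word s -> minimal_word s' ->
  inv_ideal s = inv_ideal s' -> act s =1 act s'.
Proof.
case=> sPi s0 st [s'Pi s'0 s't] eN; apply: act_id_subset => // g gD g0.
have [//|g0'] := act_pos_or_neg s'Pi gD.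
have neg x : hgt (act s x) < 0 -> hgt (act s (- x)) < 0 -> False.
  by rewrite actN hgtN oppr_lt0 => /lt_trans h /h; rewrite ltxx.
case: (degreeP gD) => [-> //|[gD1|[gt|[gD1|gt]]]].
- have : theta - g \in inv_ideal s'.
    apply/inv_idealP; rewrite theta_sub_Delta1E; split=> //.
    by rewrite opprB addrCA subrr addr0.
  rewrite -eN => /inv_idealP[_]; rewrite opprB addrCA subrr addr0.
  by move=> /(lt_trans g0); rewrite ltxx.
- have [/s'0 -> //|gn] := root_pos_or_neg gD.
  have := s0 (- g); rewrite opp_rootE linearNl /= gt oppr0 hgtN oppr_gt0.
  move=> /(_ gD erefl gn); rewrite actN hgtN oppr_gt0 => /(lt_trans g0).
  by rewrite ltxx.
- have : theta - - g \in inv_ideal s.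
    apply/inv_idealP; rewrite theta_sub_Delta1E; split=> //.
    by rewrite opprB addrCA subrr addr0 actN hgtN oppr_lt0.
  rewrite eN => /inv_idealP[_]; rewrite opprB addrCA subrr addr0 actN hgtN.
  by rewrite oppr_lt0.
- by move: g0; rewrite gt actN hgtN oppr_gt0 => /(lt_trans st); rewrite ltxx.
Qed.

Lemma act_theta_inj s s' : minimal_word s -> minimal_word s' ->
  act s theta = act s' theta -> act s =1 act s'.
Proof.
case=> sPi s0 st [s'Pi s'0 s't] et.
have rsPi := sub_rev sPi; have rs'Pi := sub_rev s'Pi.
suff e : act (rev s') =1 act (rev s).
  by move=> x; rewrite -[LHS](actVK _ s'Pi) e actK.
apply: act_id_subset => // g gD g0.
have [//|g0'] := act_pos_or_neg rsPi gD.
set x := act (rev s') g in g0; set y := act (rev s) g in g0' *.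
have xD : x \in Delta by rewrite act_rootE.
have yD : y \in Delta by rewrite act_rootE.
have xy : ip x theta = ip y theta.
  by rewrite -(act_ip x theta s'Pi) -(act_ip y theta sPi) !actVK // et.
have := pos_ip_theta xD g0; rewrite le_eqVlt => /orP[/eqP x0|]; last first.
  by rewrite xy => /(ip_theta_gt0_pos yD).
have t0 v : ip v theta = 0 -> ip v tv = 0.
  by rewrite ip_coroot => ->; rewrite mulr0 mul0r.
have := s'0 x xD (t0 _ (esym x0)) g0; have := s0 (- y).
rewrite opp_rootE linearNl /= t0 -?xy -?x0 // oppr0 hgtN oppr_gt0.
move=> /(_ yD erefl g0'); rewrite actN !actVK // hgtN oppr_gt0 => /lt_trans h /h.
by rewrite ltxx.
Qed.

Lemma card_fset_count (T : choiceType) (D : {fset T}) (P : pred T) :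
  #|` [fset d in D | P d]| = count P D.
Proof.
rewrite -size_filter; apply/perm_size/uniq_perm.
- exact: fset_uniq.
- exact/filter_uniq/fset_uniq.
- by move=> d; rewrite mem_filter !inE /= andbC.
Qed.

Definition negcount b := #|` [fset d in Delta | (0 < hgt d) && (ip d b < 0)]|.

Lemma card_inv_ideal s : minimal_word s ->
  #|` inv_ideal s| = negcount (act s theta).
Proof.
case=> sPi s0 st; rewrite /negcount.
have inj : {in inv_ideal s &, injective (fun g => - act s (theta - g))}.
  by move=> x y _ _ /oppr_inj /(act_inj sPi) /addrI /oppr_inj.
move/card_in_imfsetP/eqP: inj => <-; congr #|` _|; apply/fsetP => d.
apply/imfsetP/idP => [[g /inv_idealP[gD1 g0] ->]|].
  have [tgD tg1] := Delta1P _ (theta_sub_Delta1 gD1).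
  rewrite !inE /= opp_rootE act_rootE // tgD hgtN oppr_gt0 g0 /=.
  by rewrite linearNl /= act_ip // oppr_lt0 -ip_tv_gt0 tg1.
rewrite !inE /= => /and3P[dD d0 dt].
pose x := act (rev s) (- d).
have ex : act s x = - d by rewrite actVK.
have xD : x \in Delta by rewrite -(act_rootE x sPi) ex opp_rootE.
have xt : 0 < ip x tv.
  by rewrite ip_tv_gt0 -(act_ip x theta sPi) ex linearNl /= oppr_gt0.
have xn : hgt (act s x) < 0 by rewrite ex hgtN oppr_lt0.
have xD1 : x \in Delta1.
  have [e|//] := positive_degreeP xD xt.
  by move: xn; rewrite e => /(lt_trans st); rewrite ltxx.
exists (theta - x); last by rewrite opprB addrCA subrr addr0 ex opprK.
apply/inv_idealP; rewrite theta_sub_Delta1E; split=> //.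
by rewrite opprB addrCA subrr addr0.
Qed.

Lemma big_pos_neg (A : Type) (idx : A) (op : Monoid.com_law idx)
    (D : {fset V}) (P : pred V) (F : V -> A) :
  D `<=` Delta -> (forall g, g \in D -> - g \in D) ->
  \big[op/idx]_(g <- D | P g) F g =
  op (\big[op/idx]_(g <- D | (0 < hgt g) && P g) F g)
     (\big[op/idx]_(g <- D | (0 < hgt g) && P (- g)) F (- g)).
Proof.
move=> DD Dopp; rewrite (bigID (fun g => 0 < hgt g)) /=; congr (op _ _).
  by apply: eq_bigl => g; rewrite andbC.
have perm : perm_eq [seq - g | g <- enum_fset D] (enum_fset D).
  apply: uniq_perm; rewrite ?map_inj_uniq ?fset_uniq //; first exact: oppr_inj.
  move=> g; apply/mapP/idP => [[h hD ->]|gD]; first exact: Dopp.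
  by exists (- g); rewrite ?opprK //; apply: Dopp.
rewrite -(perm_big _ perm) /= big_map big_seq_cond [RHS]big_seq_cond.
apply: eq_bigl => g; case: (boolP (g \in _)) => //= gD.
have gDelta : g \in Delta by apply: (fsubsetP DD).
rewrite hgtN oppr_gt0 andbC; congr (_ && _).
by have := root_hgt_neq0 gDelta; case: ltrgtP.
Qed.

Lemma long_sub : long `<=` Delta.
Proof. by apply/fsubsetP => b /longP[]. Qed.

Lemma opp_long b : b \in long -> - b \in long.
Proof.
move=> /longP[bD bb]; apply/longP.
by rewrite opp_rootE linearNl /= linearNr /= opprK.
Qed.

Lemma negcount_opp b : b \in long -> 0 < hgt b ->
  (negcount b + negcount (- b))%N = (#|` Delta1|).+1.
Proof.
move=> bl b0; have [s [sPi _ _] eb] := long_word bl b0.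
have opD g : g \in Delta -> - g \in Delta by rewrite opp_rootE.
have split_neg : (negcount (- b) + negcount b)%N =
    #|` [fset d in Delta | 0 < ip d b]|.
  rewrite /negcount !card_fset_count -!sum1_count.
  rewrite [RHS](big_pos_neg _ _ _ (fsubset_refl _) opD) /=.
  congr (_ + _)%N; apply: eq_bigl => d; congr (_ && _).
    by rewrite linearNr /= oppr_lt0.
  by rewrite linearNl /= oppr_gt0.
rewrite addnC split_neg.
have inj : {in theta |` Delta1 &, injective (act s)}.
  by move=> x y _ _; apply: act_inj.
have -> : (#|` Delta1|).+1 = #|` theta |` Delta1|.
  by rewrite cardfsU1 theta_notin_Delta1.
move/card_in_imfsetP/eqP: inj => <-; congr #|` _|; apply/fsetP => d.
apply/idP/imfsetP => [|[g]] /=.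
  rewrite !inE /= => /andP[dD d0].
  pose x := act (rev s) d.
  have ex : act s x = d by rewrite actVK.
  have xD : x \in Delta by rewrite -(act_rootE x sPi) ex.
  have xt : 0 < ip x tv by rewrite ip_tv_gt0 -(act_ip x theta sPi) ex eb.
  exists x => //; rewrite in_fset1U.
  by have [->|->] := positive_degreeP xD xt; rewrite ?eqxx ?orbT.
rewrite in_fset1U => /orP[/eqP ->|/Delta1P[gD g1]] ->; rewrite !inE /= -eb;
  rewrite act_rootE // act_ip // -ip_tv_gt0.
  by rewrite theta_root ip_tv_theta ltr0n.
by rewrite gD g1 ltr01.
Qed.

Definition af_ideals : seq {fset V} :=
  [seq J <- fpowerset Delta1 | `[< upper J >] && antipode_free J].

Lemma af_idealsP I :
  reflect (upper I /\ antipode_free I) (I \in af_ideals).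
Proof.
rewrite mem_filter -andbA; apply: (iffP and3P) => [[/asboolP]|[upI afI]] //.
by split=> //; [apply/asboolP|rewrite fpowersetE; case: upI].
Qed.

Lemma card_af_ideals :
  perm_eq [seq #|` J| | J : {fset V} <- af_ideals]
    [seq negcount b | b <- [seq b <- long | 0 < hgt b]].
Proof.
have /choice[f fP] : forall I, exists s, I \in af_ideals ->
    minimal_word s /\ inv_ideal s = I.
  move=> I; have [/af_idealsP[upI afI]|] := boolP (I \in af_ideals);
    last by exists [::].
  by have [s [? ? _]] := ideal_word upI afI; exists s.
have -> : [seq #|` J| | J : {fset V} <- af_ideals] =
    [seq negcount b | b <- [seq act (f J) theta | J <- af_ideals]].
  rewrite -map_comp; apply/eq_in_map => I /fP[gs eN] /=.
  by rewrite -card_inv_ideal // eN.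
apply/perm_map/uniq_perm.
- rewrite map_inj_in_uniq; first exact/filter_uniq/fset_uniq.
  move=> I J /fP[gI eI] /fP[gJ eJ] /(act_theta_inj gI gJ) e.
  rewrite -eI -eJ; apply/fsetP => g.
  by apply/inv_idealP/inv_idealP; rewrite e.
- exact/filter_uniq/fset_uniq.
move=> b; rewrite mem_filter; apply/mapP/andP => [[I /fP[[sPi s0 st] eN] ->]|].
  split=> //; apply/longP.
  by rewrite act_rootE // act_ip // theta_root.
case=> b0 bl; have [s gs eb] := long_word bl b0.
have NsI : inv_ideal s \in af_ideals.
  by apply/af_idealsP; split;
    [exact: inv_ideal_upper|exact: inv_ideal_antipode_free].
exists (inv_ideal s) => //; have [gf ef] := fP _ NsI.
by rewrite -eb (inv_ideal_inj gf gs).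
Qed.

Lemma af_ideal_card_lt I : I \in af_ideals -> #|` I|%:R < hgt theta.
Proof.
case/af_idealsP=> upI afI; have [s [[_ _ st] _ le]] := ideal_word upI afI.
by apply: lt_le_trans le; rewrite ltrDl.
Qed.

Lemma theta_sub_inj : injective (fun g : V => theta - g).
Proof. by move=> x y /addrI /oppr_inj. Qed.

Definition dual_ideal (I : {fset V}) : {fset V} :=
  [fset g in Delta1 | theta - g \notin I].

Lemma theta_subK (g : V) : theta - (theta - g) = g.
Proof. by rewrite opprB addrCA subrr addr0. Qed.

Lemma in_dual_ideal I g :
  (g \in dual_ideal I) = (g \in Delta1) && (theta - g \notin I).
Proof. by rewrite /dual_ideal in_fset. Qed.

Lemma preceq_theta_sub m g : preceq S0 m g -> preceq S0 (theta - g) (theta - m).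
Proof.
by apply: preceq_sub; rewrite opprB [RHS]addrC addrA subrK.
Qed.

Lemma dual_idealK I : I `<=` Delta1 -> dual_ideal (dual_ideal I) = I.
Proof.
move=> ID; apply/fsetP => g; rewrite !in_dual_ideal theta_sub_Delta1E theta_subK.
case: (boolP (g \in Delta1)) => [_|gD] /=; first by rewrite negbK.
by apply/esym/negP => /(fsubsetP ID); apply/negP.
Qed.

Lemma dual_ideal_sub I : dual_ideal I `<=` Delta1.
Proof. by apply/fsubsetP => g; rewrite in_dual_ideal => /andP[]. Qed.

Lemma dual_ideal_upper I : upper I -> upper (dual_ideal I).
Proof.
case=> ID upI; split; first exact: dual_ideal_sub.
move=> m g; rewrite !in_dual_ideal => /andP[mD1 mI] gD1 mg; rewrite gD1 /=.
apply: contra mI => gI; apply: upI gI _ _; first by rewrite theta_sub_Delta1E.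
exact: preceq_theta_sub.
Qed.

Lemma card_dual_ideal I : I `<=` Delta1 ->
  (#|` I| + #|` dual_ideal I|)%N = #|` Delta1|.
Proof.
move=> ID; have sub_inj : {in Delta1 `\` I &, injective (fun g => theta - g)}.
  by move=> x y _ _; apply: theta_sub_inj.
have -> : #|` dual_ideal I| = #|` Delta1 `\` I|.
  move/card_in_imfsetP/eqP: sub_inj => <-; congr #|` _|; apply/fsetP => g.
  rewrite in_dual_ideal; apply/idP/imfsetP => [/andP[gD1 gI]|[x]] /=.
    by exists (theta - g); rewrite ?theta_subK // in_fsetD theta_sub_Delta1E gI.
  rewrite in_fsetD => /andP[xI xD1] ->.
  by rewrite theta_sub_Delta1E theta_subK xD1.
by rewrite -[RHS](cardfsID I) (fsetIidPr ID).
Qed.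

Lemma antipode_free_dual I : upper I ->
  antipode_free I || antipode_free (dual_ideal I).
Proof.
move=> [ID upI]; apply/negPn/negP; rewrite negb_or => /andP[].
move=> /allPn[g gI]; rewrite negbK => gI' /allPn[h].
rewrite in_dual_ideal => /andP[hD1 hI']; rewrite negbK in_dual_ideal theta_subK.
rewrite theta_sub_Delta1E hD1 /= => hI.
have no x : x \in I -> theta - x \in I -> 0 < ip x h -> False.
  move=> xI xI' xh; have xD1 := fsubsetP ID _ xI.
  have [xD x1] := Delta1P _ xD1; have [hD h1] := Delta1P _ hD1.
  have xhD : x - h \in Delta.
    by apply: sub_root => // e; rewrite -e xI in hI.
  have xh0 : ip (x - h) tv = 0 by rewrite linearBl /= x1 h1 subrr.
  have [pos|neg] := root_pos_or_neg xhD.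
    have /preceq_theta_sub := pos_root_comb_Pi0 xhD pos xh0.
    move=> /(upI _ _ xI'); rewrite theta_sub_Delta1E => /(_ hD1).
    by apply/negP.
  have := @pos_root_comb_Pi0 (h - x); rewrite -opprB opp_rootE hgtN oppr_gt0.
  rewrite linearNl /= xh0 oppr0 => /(_ xhD neg erefl); rewrite opprB.
  by move=> /(upI _ _ xI hD1); apply/negP.
have [/(no _ gI gI')//|gh] := ltP 0 (ip g h).
apply: (no _ gI'); first by rewrite theta_subK.
rewrite linearBl /= subr_gt0; apply: (le_lt_trans gh).
by rewrite ipC -ip_tv_gt0; case/Delta1P: hD1 => _ ->.
Qed.

Lemma antipode_freeE I : I `<=` Delta1 -> antipode_free I = (I `<=` dual_ideal I).
Proof.
move=> ID; apply/antipode_freeP/fsubsetP => afI g gI.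
  by rewrite in_dual_ideal afI // (fsubsetP ID).
by have := afI g gI; rewrite in_dual_ideal => /andP[].
Qed.

Lemma antipode_free_both I : I `<=` Delta1 -> antipode_free I ->
  antipode_free (dual_ideal I) = (#|` I|.*2 == #|` Delta1|).
Proof.
move=> ID; rewrite !antipode_freeE ?dual_ideal_sub // dual_idealK // => sub.
rewrite -(card_dual_ideal ID) -addnn eqn_add2l.
apply/idP/eqP => [sub'|e].
  suff eI : I = dual_ideal I by rewrite -eI.
  by apply/eqP; rewrite eqEfsubset sub sub'.
by rewrite -(eqP (_ : I == dual_ideal I)) // eqEfcard sub e leqnn.
Qed.

Lemma ideal_polyE :
  ideal_poly Delta1 S0 =
  \sum_(J <- af_ideals) ('X^(#|` J|) + 'X^(#|` Delta1| - #|` J|)) -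
  \sum_(J <- af_ideals | #|` J|.*2 == #|` Delta1|) 'X^(#|` J|).
Proof.
have perm : perm_eq [seq dual_ideal J | J <- enum_fset (fpowerset Delta1)]
    (enum_fset (fpowerset Delta1)).
  apply: uniq_perm; rewrite ?map_inj_in_uniq ?fset_uniq //.
    move=> J K; rewrite !fpowersetE => JD KD e.
    by rewrite -(dual_idealK JD) e dual_idealK.
  move=> J; apply/mapP/idP => [[K _ ->]|]; rewrite fpowersetE.
    exact: dual_ideal_sub.
  by move=> JD; exists (dual_ideal J); rewrite ?dual_idealK // fpowersetE
    dual_ideal_sub.
have memE J : (J \in enum_fset (fpowerset Delta1)) = (J `<=` Delta1).
  exact: fpowersetE.
rewrite /ideal_poly /af_ideals big_filter big_filter_cond.
rewrite (bigID antipode_free) /= big_split -addrA; congr (_ + _).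
rewrite -[LHS](perm_big _ perm) /= big_map; apply/eqP; rewrite eq_sym subr_eq.
rewrite (bigID (fun J => #|` J|.*2 == #|` Delta1|)) addrC /=; apply/eqP.
congr (_ + _); rewrite [LHS](@big_seq_cond _ _ _ {fset V});
  rewrite [RHS](@big_seq_cond _ _ _ {fset V}); apply: eq_big => J //.
- case/andP; rewrite memE => JD /andP[_ /eqP e]; congr 'X^_.
  by rewrite -e -addnn addnK.
- rewrite memE; have [JD|] //= := boolP (J `<=` Delta1).
  have -> : `[< upper (dual_ideal J) >] = `[< upper J >].
    apply: asbool_equiv_eq; split; last exact: dual_ideal_upper.
    by move/dual_ideal_upper; rewrite dual_idealK.
  have [/asboolP upJ|] //= := boolP (`[< upper J >]).
  have := antipode_free_both JD; have := antipode_free_dual upJ.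
  by case: (antipode_free J) => //= [_ -> //| -> _].
- case/andP; rewrite memE => JD _.
  by rewrite -(card_dual_ideal JD) addKn.
Qed.

Lemma max_af_ideal : exists2 I, I \in af_ideals & #|` I|.*2 = #|` Delta1|.
Proof.
have f0 : fset0 \in af_ideals.
  apply/af_idealsP; split; last by apply/antipode_freeP => g; rewrite inE.
  by split; [exact: fsub0set|move=> m g; rewrite inE].
have [I IA Imax] : exists2 J, J \in af_ideals &
    forall K, K \in af_ideals -> (#|` K| <= #|` J|)%N.
  have [J JA] : exists J, J \in af_ideals by exists fset0.
  have [k] := ubnP (#|` Delta1| - #|` J|)%N.
  elim: k J JA => // k IHk J JA; rewrite ltnS => le.
  have [/allP max|/allPn[K KA]] :=
    boolP (all (fun K : {fset V} => #|` K| <= #|` J|)%N af_ideals).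
    by exists J.
  rewrite -ltnNge => JK; apply: (IHk K) => //.
  apply: leq_trans le; apply: ltn_sub2l => //.
  by apply: leq_trans JK (fsubset_leq_card _); have /af_idealsP[[]] := KA.
exists I => //; have [upI afI] := af_idealsP _ IA; have [ID upI'] := upI.
apply/eqP; rewrite -antipode_free_both // antipode_freeE ?dual_ideal_sub //.
rewrite dual_idealK //; apply/negPn/negP => nsub.
pose X := dual_ideal I `\` I.
have X0 : X != fset0 by rewrite fsetD_eq0.
have [g] : exists2 g, g \in X & forall x, x \in X -> hgt x <= hgt g.
  have [y yX] := fset0Pn X X0.
  have X'0 : [fset - x | x in X] != fset0.
    by apply/fset0Pn; exists (- y); apply/imfsetP; exists y.
  have [_ /imfsetP[g gX ->] gmin] := min_hgt X'0.
  exists g => // x xX; rewrite -lerN2 -!hgtN; apply: gmin.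
  by apply/imfsetP; exists x.
rewrite in_fsetD in_dual_ideal => /and3P[gI gD1 gI'] gmax.
suff UA : g |` I \in af_ideals by have := Imax _ UA; rewrite cardfsU1 gI ltnn.
apply/af_idealsP; split; last first.
  apply/antipode_freeP => x; rewrite !in_fset1U negb_or => /orP[/eqP ->|xI].
    by rewrite theta_sub_neq.
  rewrite (antipode_freeP _ afI) // andbT.
  by apply: contraNneq gI' => <-; rewrite theta_subK.
split; first by rewrite fsubUset fsub1set gD1.
move=> m x; rewrite !in_fset1U => /orP[/eqP ->|mI] xD1 mx; last first.
  by rewrite (upI' _ _ mI) ?orbT.
have [//|xg] := eqVneq x g; apply/negPn/negP => /= xI.
have [xI'|xI'] := boolP (theta - x \in I).
  have := upI' _ _ xI' _ (preceq_theta_sub mx).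
  by rewrite theta_sub_Delta1E => /(_ gD1); apply/negP.
have xX : x \in X by rewrite in_fsetD in_dual_ideal xI xD1 xI'.
by move/eqP: xg; apply; apply/esym/preceq_antisym/gmax.
Qed.

(** * Macdonald's identity *)

Definition wt (c : 'I_n -> nat) v : R := \sum_(i < n) coord Pi i v * (c i)%:R.

Definition zwt c v : int := Num.floor (wt c v).

Lemma wtD c x y : wt c (x + y) = wt c x + wt c y.
Proof.
by rewrite /wt -big_split; apply: eq_bigr => i _; rewrite linearD mulrDl.
Qed.

Lemma wtZ c k x : wt c (k *: x) = k * wt c x.
Proof.
by rewrite /wt mulr_sumr; apply: eq_bigr => i _; rewrite linearZ /= mulrA.
Qed.

Lemma wtN c x : wt c (- x) = - wt c x.
Proof. by rewrite -scaleN1r wtZ mulN1r. Qed.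

Lemma hgt_wt v : hgt v = wt (fun=> 1%N) v.
Proof. by apply: eq_bigr => i _; rewrite mulr1. Qed.

Lemma ht_zwt v : ht Pi v = zwt (fun=> 1%N) v.
Proof. by rewrite /zwt -hgt_wt. Qed.

Lemma zwtE c g : g \in Delta -> (zwt c g)%:~R = wt c g.
Proof.
suff pos x : x \in Delta -> 0 < hgt x -> exists k : int, wt c x = k%:~R.
  move=> gD; suff [k ek] : exists k : int, wt c g = k%:~R.
    by rewrite /zwt ek intrKfloor.
  have [/(pos g gD) //|gn] := root_pos_or_neg gD.
  have := pos (- g); rewrite opp_rootE hgtN oppr_gt0 => /(_ gD gn)[k ek].
  by exists (- k); rewrite mulrNz -ek wtN opprK.
move=> xD x0; have xc i := pos_root_coord i xD x0.
have [f fE] := choice xc.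
exists (\sum_(i < n) (f i * c i)%N%:Z).
rewrite rmorph_sum; apply: eq_bigr => i _.
by rewrite fE /= -natrM pmulrn.
Qed.

Lemma wt_gt0 c g : (forall i, (0 < c i)%N) -> g \in Delta -> 0 < hgt g ->
  0 < wt c g.
Proof.
move=> c0 gD g0; apply: (lt_le_trans g0); apply: ler_sum => i _.
by rewrite ler_peMr ?ler1n ?c0 // pos_root_coord_ge0.
Qed.

Lemma zwt_gt0 c g : (forall i, (0 < c i)%N) -> g \in Delta -> 0 < hgt g ->
  0 < zwt c g.
Proof. by move=> c0 gD g0; rewrite -(ltr0z R) zwtE // wt_gt0. Qed.

Lemma zwtN c g : g \in Delta -> zwt c (- g) = - zwt c g.
Proof.
move=> gD; apply: (@intr_inj R); rewrite mulrNz !zwtE ?opp_rootE //.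
by rewrite wtN.
Qed.

Lemma zwt_reflection d g : d \in Delta -> g \in Delta ->
  exists k : int, forall c, zwt c (s_ d g) = zwt c g - k * zwt c d.
Proof.
move=> dD gD; have [k ek] := coroot_int dD gD; exists k => c.
apply: (@intr_inj R); rewrite intrB intrM !zwtE ?reflection_root //.
by rewrite /reflection ek -scaleNr wtD wtZ mulNr.
Qed.

(* For t not a root of unity and y_g = t^ht(g) X^a(g), such a weight a makes the
   polynomials 1 - y_g, g a positive root, pairwise coprime. *)
Lemma generic_weight : exists c : 'I_n -> nat, (forall i, (0 < c i)%N) /\
  forall g g', g \in Delta -> g' \in Delta -> 0 < hgt g -> 0 < hgt g' ->
    hgt g * wt c g' = hgt g' * wt c g -> g = g'.
Proof.
pose coef g g' i := hgt g * coord Pi i g' - hgt g' * coord Pi i g.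
pose p g g' : {poly R} := \sum_(i < n) coef g g' i *: 'X^i.
have coefp g g' (i : 'I_n) : (p g g')`_i = coef g g' i.
  rewrite coef_sum (bigD1 i) //= coefZ coefXn eqxx mulr1 big1 ?addr0 // => j ji.
  rewrite coefZ coefXn; have [/val_inj e|_] := @eqP nat i j; last by rewrite mulr0.
  by rewrite e eqxx in ji.
have badP g g' : g \in Delta -> g' \in Delta -> 0 < hgt g -> 0 < hgt g' ->
    g <> g' -> p g g' != 0.
  move=> gD g'D g0 g'0 gg'; apply/eqP => pz; apply: gg'.
  have eg : hgt g *: g' = hgt g' *: g.
    rewrite [in LHS](simple_span g') [in RHS](simple_span g) !scaler_sumr.
    apply: eq_bigr => i _; rewrite !scalerA; congr (_ *: _).
    by apply/eqP; rewrite -subr_eq0 -/(coef g g' i) -coefp pz coef0.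
  have eg' : g' = (hgt g' / hgt g) *: g.
    by rewrite mulrC -scalerA -eg scalerA mulVf ?scale1r // gt_eqF.
  have := g'D; rewrite {1}eg' => /(roots_reduced hDelta gD) [] e.
    by rewrite eg' e scale1r.
  by have := divr_gt0 g'0 g0; rewrite e ltr0N1.
pose P := \prod_(g <- Delta) \prod_(g' <- Delta | p g g' != 0) p g g'.
have P0 : P != 0.
  rewrite prodf_seq_neq0; apply/allP => g _ /=; rewrite prodf_seq_neq0.
  by apply/allP => g' _; apply/implyP.
have [N N0 PN] : exists2 N : nat, (0 < N)%N & P.[N%:R] != 0.
  have [/hasP[N]|/hasPn no] :=
      boolP (has (fun N => P.[N%:R] != 0) (iota 1 (size P))).
    by rewrite mem_iota => /andP[N0 _] PN; exists N.
  move: P0; rewrite (@roots_geq_poly_eq0 _ P [seq k%:R | k <- iota 1 (size P)]).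
  - by rewrite eqxx.
  - by apply/allP => x /mapP[k /no]; rewrite negbK /root => ? ->.
  - by rewrite map_inj_uniq ?iota_uniq // => i j /eqP; rewrite eqr_nat => /eqP.
  - by rewrite size_map size_iota.
exists (fun i => N ^ i)%N; split=> [i|g g' gD g'D g0 g'0 e].
  by rewrite expn_gt0 N0.
apply/eqP/negPn/negP => /eqP /(badP g g' gD g'D g0 g'0) pz.
move: PN; rewrite /P horner_prod (bigD1_seq g gD (fset_uniq _)) /= horner_prod.
rewrite (big_rem g') //= pz.
suff -> : (p g g').[N%:R] = 0 by rewrite !mul0r eqxx.
rewrite horner_sum; under eq_bigr do rewrite hornerZ hornerXn -natrX /coef mulrBl.
rewrite sumrB; apply/eqP; rewrite subr_eq0; apply/eqP.
transitivity (hgt g * wt (fun i => N ^ i)%N g').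
  by rewrite mulr_sumr; apply: eq_bigr => i _; rewrite mulrA.
by rewrite e mulr_sumr; apply: eq_bigr => i _; rewrite mulrA.
Qed.

Section Macdonald.

Variables (C : numClosedFieldType) (t : C).

(* Whichever of g and - g is positive on b contributes (1 - t / y) / (1 - 1 / y)
   or (1 - t y) / (1 - y); this is its numerator over 1 - y, with y = u. *)
Definition mfactor (b g : V) (A : comNzRingType) (t' u : A) : A :=
  if 0 < ip g b then 1 - t' * u else if ip g b < 0 then t' - u else 1 - u.

Definition sign_ip b d : C :=
  if 0 < ip d b then 1 else if ip d b < 0 then -1 else 0.

Lemma perm_reflection (D : {fset V}) d : d \in Delta ->
  (forall g, g \in D -> s_ d g \in D) ->
  perm_eq [seq s_ d g | g <- enum_fset D] (enum_fset D).
Proof.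
move=> dD DD; have sK := reflectionK ip (root_neq0 dD).
apply: uniq_perm; rewrite ?fset_uniq ?map_inj_uniq ?fset_uniq //.
  exact: can_inj sK.
move=> g; apply/mapP/idP => [[h hD ->]|gD]; first exact: DD.
by exists (s_ d g); rewrite ?sK //; apply: DD.
Qed.

(* Where y d = 1, the reflection s_d permutes the terms and changes the sign of
   the factor of index d, so that the sum is its own opposite. *)
Lemma sum_mfactor_eq0 (y : V -> C) d : d \in Delta -> 0 < hgt d -> y d = 1 ->
  (forall g, g \in Delta -> y (- g) = (y g)^-1) ->
  (forall g, g \in Delta -> y (s_ d g) = y g) ->
  (forall g, g \in Delta -> y g != 0) ->
  (forall g, g \in Delta -> 0 < hgt g -> g != d -> y g != 1) ->
  \sum_(b <- long) \prod_(g <- Delta | 0 < hgt g) mfactor b g t (y g) = 0.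
Proof.
move=> dD d0 yd yN ys y0 y1.
have sK := reflectionK ip (root_neq0 dD).
pose psi g := (1 - t * y g) / (1 - y g).
pose E b := \prod_(g <- Delta | [&& g != d, g != - d & 0 < ip g b]) psi g.
pose N := \prod_(g <- Delta | (0 < hgt g) && (g != d)) (1 - y g).
have term b : \prod_(g <- Delta | 0 < hgt g) mfactor b g t (y g) =
    (1 - t) * N * (sign_ip b d * E b).
  rewrite -big_filter (bigD1_seq d) ?filter_uniq ?fset_uniq ?mem_filter ?d0 //=.
  rewrite big_filter_cond.
  have -> : mfactor b d t (y d) = (1 - t) * sign_ip b d.
    by rewrite /mfactor /sign_ip yd; case: ifP => _; [ring|case: ifP => _; ring].
  suff -> : \prod_(g <- Delta | (0 < hgt g) && (g != d)) mfactor b g t (y g) =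
    N * E b by ring.
  have opD g : g \in Delta -> - g \in Delta by rewrite opp_rootE.
  have nd g : 0 < hgt g -> g != - d.
    by move=> g0; apply: contraTneq g0 => ->; rewrite hgtN oppr_gt0 lt_gtF.
  have -> : E b =
      \prod_(g <- Delta | (0 < hgt g) && (g != d))
        (if 0 < ip g b then psi g else 1) *
      \prod_(g <- Delta | (0 < hgt g) && (g != d))
        (if ip g b < 0 then psi (- g) else 1).
    rewrite /E (big_pos_neg _ _ _ (fsubset_refl _) opD) /= -!big_mkcondr /=.
    congr (_ * _); apply: eq_bigl => g.
      by case: (boolP (0 < hgt g)) => // /nd -> /=.
    rewrite eqr_oppLR (inj_eq oppr_inj) linearNl /= oppr_gt0.
    by case: (boolP (0 < hgt g)) => // /nd -> /=.
  rewrite -big_split -big_split /= big_seq_cond [RHS]big_seq_cond.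
  apply: eq_bigr => g /and3P[gD g0 gd].
  have yg1 : 1 - y g != 0 by rewrite subr_eq0 eq_sym y1.
  have yg0 := y0 g gD.
  rewrite /mfactor /psi yN //; case: ltgtP => _.
  - by rewrite mulr1 mulrCA divff ?mulr1.
  - have e1 : 1 - t * (y g)^-1 = (t - y g) * (- (y g)^-1) by field.
    have e2 : 1 - (y g)^-1 = (1 - y g) * (- (y g)^-1) by field.
    have y'0 : - (y g)^-1 != 0 by rewrite oppr_eq0 invr_eq0.
    by rewrite mul1r e1 e2 -mulf_div divff // mulr1 mulrCA divff // mulr1.
  - by rewrite !mulr1.
under eq_bigr do rewrite term.
rewrite -mulr_sumr; suff -> : \sum_(b <- long) sign_ip b d * E b = 0.
  by rewrite mulr0.
set S := \sum_(b <- long) _.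
suff : S = - S.
  by move/eqP; rewrite -addr_eq0 -mulr2n mulrn_eq0 => /eqP.
have ipd b : ip d (s_ d b) = - ip d b.
  by rewrite -ip_reflectionl ?root_neq0 // reflection_self ?root_neq0 // linearNl.
rewrite {1}/S -(perm_big _ (perm_reflection dD _)) => [|b];
  last exact: reflection_long.
rewrite big_map /S -sumrN; apply: eq_bigr => b _; rewrite -mulNr; congr (_ * _).
  by rewrite /sign_ip ipd oppr_gt0 oppr_lt0; case: ltgtP;
    rewrite ?opprK ?oppr0.
rewrite /E -(perm_big _ (perm_reflection dD _)) => [|g];
  last exact: reflection_root.
rewrite big_map big_seq_cond [RHS]big_seq_cond; apply: eq_big => g.
  case: (boolP (g \in _)) => //= gD.
  have -> : (s_ d g == d) = (g == - d).
    by rewrite -(inj_eq (can_inj sK)) sK reflection_self ?root_neq0.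
  have -> : (s_ d g == - d) = (g == d).
    by rewrite -(inj_eq (can_inj sK)) sK reflectionN reflection_self ?root_neq0 //
      opprK.
  by rewrite ip_reflection ?root_neq0 // andbCA.
by move=> /andP[gD _]; rewrite /psi ys.
Qed.

Definition hn g : nat := `|ht Pi g|%N.

Lemma hnE g : g \in Delta -> 0 < hgt g -> ht Pi g = hn g.
Proof.
by move=> gD g0; rewrite /hn ht_zwt gtz0_abs // zwt_gt0.
Qed.

Lemma hn_hgt g : g \in Delta -> 0 < hgt g -> (hn g)%:R = hgt g.
Proof.
move=> gD g0; rewrite hgt_wt -(zwtE _ gD) -ht_zwt hnE //.
Qed.

Lemma hn_gt0 g : g \in Delta -> 0 < hgt g -> (0 < hn g)%N.
Proof. by move=> gD g0; rewrite -(ltr0n R) hn_hgt. Qed.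

Lemma horner_mfactor b g (u : {poly C}) z :
  (mfactor b g t%:P u).[z] = mfactor b g t u.[z].
Proof.
by rewrite /mfactor; case: ifP => _; [|case: ifP => _];
  rewrite !(hornerD, hornerN, hornerM, hornerC).
Qed.

Lemma size_mfactor b g (u : {poly C}) k : (size u <= k.+1)%N ->
  (size (mfactor b g t%:P u) <= k.+1)%N.
Proof.
have sizeB (v w : {poly C}) :
    (size v <= k.+1)%N -> (size w <= k.+1)%N -> (size (v - w)%R <= k.+1)%N.
  by move=> sv sw; rewrite (leq_trans (size_polyD _ _)) // size_polyN geq_max sv.
have szC (x : C) : (size (x%:P) <= k.+1)%N.
  exact: leq_trans (size_polyC_leq1 _) _.
move=> su; rewrite /mfactor -[1]/(1%:P).
case: ifP => _; [|case: ifP => _]; apply: sizeB => //.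
by rewrite mul_polyC (leq_trans (size_scale_leq _ _)).
Qed.

Lemma poincare_product : t != 0 -> (forall k, (0 < k)%N -> t ^+ k != 1) ->
  (\sum_(b <- long) t ^+ negcount b) *
    (\prod_(g <- Delta1) (1 - t ^+ hn g) * (1 - t ^+ hn theta)) =
  \prod_(g <- Delta1) (1 - t ^+ (hn g).+1) * (1 - t ^+ (hn theta).+1).
Proof.
move=> t0 tk.
have [c [c0 cgen]] := generic_weight.
pose a g := `|zwt c g|%N.
have aE g : g \in Delta -> 0 < hgt g -> zwt c g = a g.
  by move=> gD g0; rewrite /a gtz0_abs // zwt_gt0.
have a_gt0 g : g \in Delta -> 0 < hgt g -> (0 < a g)%N.
  by move=> gD g0; rewrite absz_gt0 gt_eqF // zwt_gt0.
have aR g : g \in Delta -> 0 < hgt g -> (a g)%:R = wt c g.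
  by move=> gD g0; rewrite -(zwtE _ gD) aE.
have texp_inj i j : t ^+ i = t ^+ j -> i = j.
  wlog le : i j / (i <= j)%N.
    by move=> H; case/orP: (leq_total i j) => le e; [|apply/esym]; apply: H.
  move=> e; apply/eqP; rewrite eqn_leq le -subn_eq0 /= -leqn0 leqNgt.
  apply/negP => /tk /eqP; apply; apply: (mulIf (expf_neq0 i t0)).
  by rewrite -exprD subnK // mul1r.
pose s := [seq g <- Delta | 0 < hgt g].
have sP g : (g \in s) = (0 < hgt g) && (g \in Delta) by rewrite mem_filter.
have us : uniq s by exact/filter_uniq/fset_uniq.
pose P := \prod_(g <- s) (1 - (t ^+ hn g) *: 'X^(a g)).
pose Q := \sum_(b <- long) \prod_(g <- s)
  mfactor b g t%:P ((t ^+ hn g) *: 'X^(a g)).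
have Qz z : Q.[z] =
    \sum_(b <- long) \prod_(g <- s) mfactor b g t (t ^+ hn g * z ^+ a g).
  rewrite horner_sum; apply: eq_bigr => b _; rewrite horner_prod.
  by apply: eq_bigr => g _; rewrite horner_mfactor hornerZ hornerXn.
have Pz z : P.[z] = \prod_(g <- s) (1 - t ^+ hn g * z ^+ a g).
  rewrite horner_prod; apply: eq_bigr => g _.
  by rewrite hornerD hornerN hornerC hornerZ hornerXn.
have a0s : {in s, forall g, (0 < a g)%N}.
  by move=> g; rewrite sP => /andP[g0 gD]; apply: a_gt0.
have t0s : {in s, forall g, t ^+ hn g != 0} by move=> g _; apply: expf_neq0.
have disj : {in s &, forall g g', g != g' -> forall z,
    t ^+ hn g * z ^+ a g = 1 -> t ^+ hn g' * z ^+ a g' != 1}.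
  move=> g g'; rewrite !sP => /andP[g0 gD] /andP[g'0 g'D] gg' z e.
  apply: contra_neqN gg' => /eqP e'; apply: cgen => //.
  rewrite -(hn_hgt gD g0) -(hn_hgt g'D g'0) -(aR _ gD g0) -(aR _ g'D g'0) -!natrM.
  suff -> : (hn g * a g' = hn g' * a g)%N by [].
  apply: texp_inj; rewrite !exprM.
  have zn0 : z ^+ (a g * a g') != 0.
    rewrite expf_neq0 //; apply: contra_eq_neq e => ->.
    by rewrite expr0n eqn0Ngt a_gt0 // mulr0 eq_sym oner_eq0.
  apply: (mulIf zn0); rewrite {1}exprM -exprMn e expr1n.
  by rewrite mulnC exprM -exprMn e' expr1n.
have sepP : separable_poly P by apply: separable_prod_1subcXn.
have PQ : P %| Q.
  apply: separable_dvdp => // z; rewrite /root Pz prodf_seq_eq0.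
  case/hasP => d; rewrite sP => /andP[d0 dD] /=; rewrite subr_eq0 => /eqP yd.
  have zn0 : z != 0.
    apply: contra_eq_neq yd => ->.
    by rewrite expr0n eqn0Ngt a_gt0 // mulr0 oner_eq0.
  pose y g := t ^ ht Pi g * z ^ zwt c g.
  have yE g : g \in Delta -> 0 < hgt g -> y g = t ^+ hn g * z ^+ a g.
    by move=> gD g0; rewrite /y hnE // aE.
  rewrite Qz.
  rewrite -[X in X == _](_ : \sum_(b <- long) \prod_(g <- Delta | 0 < hgt g)
      mfactor b g t (y g) = _); last first.
    apply: eq_bigr => b _; rewrite -big_filter -/s big_seq [RHS]big_seq.
    by apply: eq_bigr => g; rewrite sP => /andP[g0 gD]; rewrite yE.
  have yd1 : y d = 1 by rewrite yE.
  apply/eqP/(sum_mfactor_eq0 dD d0 yd1).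
  - by move=> g gD; rewrite /y !ht_zwt !zwtN // invfM -!invr_expz.
  - move=> g gD; have [k ek] := zwt_reflection dD gD.
    have expk (x : C) i j : x != 0 -> x ^ (i - k * j) = x ^ i * (x ^ j) ^ (- k).
      by move=> x0; rewrite expfzDr // exprz_exp mulrN [j * k]mulrC.
    rewrite /y !ht_zwt !ek !expk // mulrACA -expfzMl.
    by move: yd1; rewrite /y ht_zwt => ->; rewrite exp1rz mulr1.
  - by move=> g gD; rewrite /y mulf_neq0 // expfz_neq0.
  - move=> g gD g0 gd; rewrite yE //; apply: (disj d g); rewrite ?sP ?d0 ?g0 //.
    by rewrite eq_sym.
have szQ : (size Q <= size P)%N.
  rewrite size_prod_1subcXn //; apply: leq_trans (size_sum _ _ _) _.
  apply: (big_ind (fun k => k <= (\sum_(g <- s) a g).+1)%N) => // [k l kl kl'|b _].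
    by rewrite geq_max kl.
  elim: (s) => [|g r IHr]; first by rewrite !big_nil size_poly1.
  rewrite !big_cons; apply: leq_trans (size_polyMleq _ _) _.
  have : (size (mfactor b g t%:P ((t ^+ hn g) *: 'X^(a g))%R) <= (a g).+1)%N.
    apply: size_mfactor; apply: leq_trans (size_scale_leq _ _) _.
    by rewrite size_polyXn.
  by move: IHr; lia.
have P0 : P.[0] = 1.
  rewrite Pz big_seq big1 // => g gs.
  by rewrite expr0n eqn0Ngt a0s // mulr0 subr0.
have := dvdp_size_scale P0 PQ szQ => /(congr1 (horner^~ 1)).
rewrite hornerZ Pz.
under eq_bigr do rewrite expr1n mulr1.
have -> : Q.[0] = \sum_(b <- long) t ^+ negcount b.
  rewrite Qz; apply: eq_bigr => b _; rewrite /negcount card_fset_count.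
  rewrite (eq_big_seq (fun g => if ip g b < 0 then t else 1)).
    rewrite -big_mkcond /= big_const_seq iter_mulr_1 count_filter.
    suff -> : count (predI (fun g => ip g b < 0) (fun g => 0 < hgt g)) Delta =
      count (fun g => (0 < hgt g) && (ip g b < 0)) Delta by [].
    by apply: eq_count => g /=; rewrite andbC.
  move=> g gs; rewrite expr0n eqn0Ngt a0s //= mulr0 /mfactor.
  by rewrite mulr0 !subr0; case: ltgtP.
have -> : Q.[1] = \prod_(g <- s) mfactor theta g t (t ^+ hn g).
  rewrite Qz (bigD1_seq theta) ?fset_uniq ?theta_long //=.
  rewrite [X in _ + X]big1_seq ?addr0 => [|b /andP[bt bl]].
    by apply: eq_bigr => g _; rewrite expr1n mulr1.
  have [/(dominant_long bl) e|[d dPi bd]] := dominant_or_not b.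
    by rewrite e eqxx in bt.
  have dD := simple_root dPi; have d0 : 0 < hgt d by rewrite hgt_simple.
  have d1 : hn d = 1%N.
    by apply/eqP; rewrite -(eqr_nat R) hn_hgt // hgt_simple.
  apply/eqP; rewrite prodf_seq_eq0; apply/hasP; exists d; first by rewrite sP d0.
  by rewrite /= /mfactor ipC bd lt_gtF // d1 expr1n mulr1 expr1 subrr.
pose S := [seq g <- s | 0 < ip g theta].
have permS : perm_eq S (theta :: enum_fset Delta1).
  apply: uniq_perm; first exact: filter_uniq.
    by rewrite /= fset_uniq theta_notin_Delta1.
  move=> g; rewrite mem_filter sP inE -ip_tv_gt0.
  apply/and3P/orP => [[gt g0 gD]|[/eqP ->|gD1]]; last 2 first.
  - by rewrite ip_tv_theta ltr0n hgt_theta_gt0 theta_root.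
  - by case/Delta1P: (gD1) => gD ->; rewrite ltr01 Delta1_pos.
  by have [->|->] := positive_degreeP gD gt; rewrite ?eqxx; [left|right].
have eqS : \prod_(g <- s | 0 < ip g theta) mfactor theta g t (t ^+ hn g) =
    \prod_(g <- theta :: enum_fset Delta1) (1 - t ^+ (hn g).+1).
  rewrite -(perm_big _ permS) /= big_filter; apply: eq_bigr => g gt.
  by rewrite /mfactor gt exprS.
have eqN : \prod_(g <- s | ~~ (0 < ip g theta)) mfactor theta g t (t ^+ hn g) =
    \prod_(g <- s | ~~ (0 < ip g theta)) (1 - t ^+ hn g).
  rewrite big_seq_cond [RHS]big_seq_cond; apply: eq_bigr => g.
  rewrite sP => /andP[/andP[g0 gD] gt]; rewrite /mfactor (negPf gt).
  by rewrite ltNge (pos_ip_theta gD g0).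
rewrite (bigID (fun g => 0 < ip g theta)) /= eqS eqN.
rewrite [in X in _ = _ * X](bigID (fun g => 0 < ip g theta)) /= mulrA.
have N0 : \prod_(g <- s | ~~ (0 < ip g theta)) (1 - t ^+ hn g) != 0.
  rewrite prodf_seq_neq0; apply/allP => g; rewrite sP.
  case/andP=> g0 gD; apply/implyP => _.
  by rewrite subr_eq0 eq_sym tk // hn_gt0.
move=> /(mulIf N0); rewrite -(big_filter s) -/S (perm_big _ permS) /= !big_cons.
by rewrite [_ * (1 - t ^+ hn theta)]mulrC => <-; rewrite mulrC.
Qed.

End Macdonald.

(** * The product formula *)

Lemma hn_theta_sub g : g \in Delta1 -> hn (theta - g) = (hn theta - hn g)%N.
Proof.
move=> gD1; have tgD1 := gD1; rewrite -theta_sub_Delta1E in tgD1.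
have e : (hn (theta - g) + hn g = hn theta)%N.
  apply/eqP; rewrite -(eqr_nat R) natrD (hn_hgt theta_root hgt_theta_gt0).
  rewrite (hn_hgt (Delta1_root gD1) (Delta1_pos gD1)).
  by rewrite (hn_hgt (Delta1_root tgD1) (Delta1_pos tgD1)) hgtB subrK.
by rewrite -e addnK.
Qed.

Lemma af_ideal_card_le I : I \in af_ideals -> (#|` I|.*2 <= #|` Delta1|)%N.
Proof.
case/af_idealsP => -[ID _]; rewrite antipode_freeE // => /fsubset_leq_card.
by rewrite -(card_dual_ideal ID) -addnn leq_add2l.
Qed.

Lemma ideal_poly_prod :
  ideal_poly Delta1 S0 * \prod_(g <- Delta1) (1 - 'X^(hn g)) =
  \prod_(g <- Delta1) (1 - 'X^((hn g).+1)).
Proof.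
have [M MA eM] := max_af_ideal; pose m := #|` M|.
pose s := [seq #|` J| | J : {fset V} <- af_ideals].
pose ks := [seq hn g | g <- enum_fset Delta1].
pose H := hn theta.
have H_hgt : H%:R = hgt theta := hn_hgt theta_root hgt_theta_gt0.
have sm : all (fun l => l <= m)%N s.
  apply/allP => l /mapP[J JA ->]; rewrite -leq_double eM.
  exact: af_ideal_card_le.
have mH : (m < H)%N by rewrite -(ltr_nat R) H_hgt; apply: af_ideal_card_lt.
have ksP : all (fun k => 0 < k < H)%N ks.
  apply/allP => k /mapP[g gD1 ->].
  have k0 x : x \in Delta1 -> (0 < hn x)%N.
    by move=> xD1; rewrite hn_gt0 ?Delta1_root ?Delta1_pos.
  rewrite k0 //=; have := k0 (theta - g); rewrite theta_sub_Delta1E.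
  by rewrite hn_theta_sub // subn_gt0; apply.
have sym : perm_eq [seq (H - k)%N | k <- ks] ks.
  rewrite -map_comp.
  have -> : [seq ((fun k => H - k)%N \o hn) g | g <- enum_fset Delta1] =
      [seq hn g | g <- [seq theta - g | g <- enum_fset Delta1]].
    by rewrite -map_comp; apply/eq_in_map => g gD1 /=; rewrite hn_theta_sub.
  apply/perm_map/uniq_perm; rewrite ?map_inj_uniq ?fset_uniq //.
    exact: theta_sub_inj.
  move=> g; apply/mapP/idP => [[x xD1 ->]|gD1].
    by rewrite theta_sub_Delta1E.
  by exists (theta - g); rewrite ?theta_sub_Delta1E ?theta_subK.
pose f : {rmorphism {poly int} -> {poly algC}} := map_poly intr.
have finj : injective f by apply: map_inj_poly => //; exact: intr_inj.
apply: finj; rewrite rmorphM !rmorph_prod /=.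
have f1X k : map_poly intr (1 - 'X^k : {poly int}) = 1 - 'X^k :> {poly algC}.
  by rewrite rmorphB /= rmorph1 map_polyXn.
under eq_bigr do rewrite f1X; under [RHS]eq_bigr do rewrite f1X.
have -> : map_poly intr (ideal_poly Delta1 S0) =
    \sum_(l <- s) ('X^l + 'X^(m.*2 - l)) - 'X^m *+ count_mem m s :> {poly algC}.
  rewrite ideal_polyE rmorphB !rmorph_sum big_map -eM /=; congr (_ - _).
    by apply: eq_bigr => J _; rewrite rmorphD /= !map_polyXn.
  transitivity (\sum_(J <- af_ideals | #|` J| == m) 'X^m : {poly algC}).
    apply: eq_big => J; first by rewrite (inj_eq double_inj).
    by rewrite (inj_eq double_inj) => /eqP ->; rewrite /= map_polyXn.
  by rewrite big_const_seq iter_addr_0 /s count_map.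
have := @palindromic_sum algC s ks m H mH sm ksP sym.
rewrite !big_map; apply.
apply: eq_poly_nat => k k1.
pose t : algC := k%:R.
have t0 : t != 0 by rewrite pnatr_eq0 -lt0n ltnW.
have tk j : (0 < j)%N -> t ^+ j != 1.
  by move=> j0; rewrite -natrX -[1]/(1%:R) eqr_nat neq_ltn orbC -(expn0 k)
    ltn_exp2l ?j0.
have e1 j : (1 - 'X^j : {poly algC}).[t] = 1 - t ^+ j.
  by rewrite hornerD hornerN hornerC hornerXn.
rewrite -/t !hornerM !horner_prod !e1.
have e2 (F : V -> nat) : \prod_(g <- Delta1) (1 - 'X^(F g) : {poly algC}).[t] =
    \prod_(g <- Delta1) (1 - t ^+ F g).
  by apply: eq_bigr => g _; rewrite e1.
rewrite !e2.
rewrite -(poincare_product t0 tk); congr (_ * _).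
have opl b : b \in long -> - b \in long := @opp_long b.
rewrite (big_pos_neg _ _ _ long_sub opl) /= -big_split /= horner_sum.
have -> : \sum_(J <- af_ideals) ('X^(#|` J|) + 'X^(m.*2.+1 - #|` J|)).[t] =
    \sum_(l <- s) (t ^+ l + t ^+ (m.*2.+1 - l)).
  by rewrite big_map; apply: eq_bigr => J _; rewrite hornerD !hornerXn.
rewrite (perm_big _ card_af_ideals) big_map big_filter /=.
rewrite [LHS]big_seq_cond [RHS]big_seq_cond; apply: eq_big => b.
  by rewrite andbT.
by case/andP=> bl b0; rewrite -/m eM -(negcount_opp bl b0) addKn.
Qed.

End RootSystem.

Theorem theorem4p5 (R : realType) (V : vectType R) (ip : {dot V for idfun})
    (Delta : {fset V}) (n : nat) (Pi : n.-tuple V) (theta : V)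
    (hDelta : irreducible_root_system ip Delta)
    (hPi : simple_roots Delta Pi)
    (htheta : highest_root Delta Pi theta) :
  let Delta1 := Delta_ ip Delta theta 1 in
  let t : {fraction {poly int}} := tofrac 'X in
  tofrac (ideal_poly Delta1 (Pi0 ip Delta Pi theta)) =
  \prod_(g <- Delta1) ((1 - t ^ (ht Pi g + 1)) / (1 - t ^ ht Pi g)).
Proof.
move=> Delta1 t.
have tX k : 1 - t ^+ k = tofrac (1 - 'X^k).
  by rewrite rmorphB /= rmorph1 rmorphXn.
have hnD1 g : g \in Delta1 -> (0 < hn Pi g)%N /\ ht Pi g = hn Pi g.
  move=> gD1; have gD := Delta1_root gD1.
  have g0 := Delta1_pos hDelta hPi htheta gD1.
  by split; [exact: (hn_gt0 hDelta hPi)|exact: (hnE hDelta hPi)].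
rewrite (eq_big_seq (fun g =>
    tofrac (1 - 'X^((hn Pi g).+1)) / tofrac (1 - 'X^(hn Pi g)))); last first.
  by move=> g /hnD1[_ ->]; rewrite -!tX -addn1.
rewrite prodf_div -!rmorph_prod -(ideal_poly_prod hDelta hPi htheta).
rewrite rmorphM mulfK // tofrac_eq0 prodf_seq_neq0; apply/allP => g /hnD1[h _] /=.
rewrite subr_eq0; apply/eqP => /(congr1 (fun p : {poly int} => size p)).
by rewrite size_poly1 size_polyXn; lia.
Qed.
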